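(* Let $G$ be a finite simple graph. Then $G$ is a CI$\mathcal{O}$ graph if and only if $G$ is a theta-ring graph.
   Context: All graphs are finite and simple; $k$ is a field. Given a graph $G$ with vertices $x_1,\dots,x_n$, $q$ edges and $r$ connected components, and an orientation $\mathcal{O}$ of its edges, $D=G_{\mathcal{O}}$ is the resulting oriented graph, with edges $t_1,\dots,t_q$. To an oriented edge $t_\ell=(x_i,x_j)$ (from $x_i$ to $x_j$) is associated $v_\ell\in\{0,1,-1\}^n$ with $i$-th entry $-1$, $j$-th entry $1$ and all other entries $0$. The toric ideal $P_D$ is the kernel of the $k$-algebra map $\varphi:k[t_1,\dots,t_q]\to k[x_1^{\pm1},\dots,x_n^{\pm1}]$, $t_\ell\mapsto x^{v_\ell}$ (i.e. $t_\ell\mapsto x_jx_i^{-1}$). It has height $q-n+r$. $P_D$ is a binomial complete intersection if it can be generated by $q-n+r$ binomials (polynomials of the form $t^\alpha-t^\beta$). $G$ is a CI$\mathcal{O}$ graph if $P_{G_{\mathcal{O}}}$ is a binomial complete intersection for every orientation $\mathcal{O}$ of $G$. A chorded-theta of $G$ is an induced subgraph $T$ of $G$ together with three paths $\mathcal{L}_1,\mathcal{L}_2,\mathcal{L}_3$ of $G$, each between two given non-adjacent vertices $x$ and $y$, such that $V(\mathcal{L}_i)\cap V(\mathcal{L}_j)=\{x,y\}$ for $1\le i<j\le 3$ and $T$ is the subgraph induced by $V(\mathcal{L}_1)\cup V(\mathcal{L}_2)\cup V(\mathcal{L}_3)$. A transversal triangle of $T$ is a triangle in $G$ having exactly one vertex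 in the interior $V(\mathcal{L}_i)\setminus\{x,y\}$ of each path $\mathcal{L}_i$, $i=1,2,3$. $G$ is a theta-ring graph if every chorded-theta of $G$ has a transversal triangle. *)

(* Defs.v *)
From mathcomp Require Import all_boot all_algebra.
From mathcomp Require Import mpoly.

Set Implicit Arguments.
Unset Strict Implicit.
Unset Printing Implicit Defensive.

Import GRing.Theory.
Local Open Scope ring_scope.

(* A finite simple graph is a finType V of vertices together with a symmetric
   and irreflexive adjacency relation e : rel V. *)

(* D is the set of arcs of an orientation of e: every edge {x, y} carries
   exactly one of the arcs (x, y), (y, x), and there are no other arcs. *)
Definition orientation (V : finType) (e : rel V) (D : {set V * V}) : Prop :=
  (forall x y, e x y = ((x, y) \in D) || ((y, x) \in D)) /\
  (forall x y, (x, y) \in D -> (y, x) \notin D).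

Section ToricIdeal.

Variables (k : fieldType) (V : finType) (D : {set V * V}).

(* The edge variable t_l is 'X_l, and the l-th arc is enum_val l. *)
Definition edge_ring := {mpoly k[#|D|]}.

(* The Laurent polynomial ring k[x^{+-1}] is the subring of the field k(x) of
   rational functions generated by k and the x_i^{+-1}; the toric map is given
   the codomain k(x), which does not change its kernel. *)
Definition rat_fun := {fraction {mpoly k[#|V|]}}.

Definition vertex_var (x : V) : rat_fun := tofrac 'X_(enum_rank x).

Definition laurent_monomial (v : V -> int) : rat_fun :=
  \prod_x vertex_var x ^ v x.

Definition arc_vector (a : V * V) : V -> int :=
  fun z => if z == a.1 then - 1 else if z == a.2 then 1 else 0.

Definition toric_map : edge_ring -> rat_fun :=
  mmap (@tofrac {mpoly k[#|V|]} \o @mpolyC #|V| k)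
       (fun l : 'I_#|D| => laurent_monomial (arc_vector (enum_val l))).

Definition toric_ideal (p : edge_ring) : Prop := toric_map p = 0.

End ToricIdeal.

Definition generates (R : comNzRingType) (h : nat) (f : 'I_h -> R)
    (I : R -> Prop) : Prop :=
  forall p, I p <-> exists c : 'I_h -> R, p = \sum_(i < h) c i * f i.

Definition is_binomial (k : fieldType) (q : nat) (p : {mpoly k[q]}) : Prop :=
  exists alpha beta : 'X_{1.. q}, p = 'X_[alpha] - 'X_[beta].

(* The height q - n + r is written q + r - n because subtraction on nat is
   truncated; q + r >= n always holds. *)
Definition binomial_complete_intersection (k : fieldType) (V : finType)
    (e : rel V) (D : {set V * V}) : Prop :=
  exists f : 'I_(#|D| + n_comp e predT - #|V|)%N -> {mpoly k[#|D|]},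
    (forall i, is_binomial (f i)) /\ generates f (@toric_ideal k V D).

Definition CIO (k : fieldType) (V : finType) (e : rel V) : Prop :=
  forall D : {set V * V},
    orientation e D -> binomial_complete_intersection k e D.

(* The path with successive vertices x :: p, ending at y. *)
Definition path_between (V : finType) (e : rel V) (x y : V) (p : seq V) : Prop :=
  [/\ path e x p, last x p = y & uniq (x :: p)].

Definition path_vertices (V : finType) (x : V) (p : seq V) : {set V} :=
  [set z in x :: p].

Definition path_interior (V : finType) (x y : V) (p : seq V) : {set V} :=
  path_vertices x p :\: [set x; y].

(* The induced subgraph is represented by its vertex set T, and the i-th path
   by the sequence L i of its vertices after x. *)
Definition chorded_theta (V : finType) (e : rel V) (T : {set V}) (x y : V)
    (L : 'I_3 -> seq V) : Prop :=
  [/\ x != y /\ ~~ e x y,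
      forall i, path_between e x y (L i),
      forall i j : 'I_3, (i < j)%N ->
        path_vertices x (L i) :&: path_vertices x (L j) = [set x; y]
    & T = \bigcup_(i < 3) path_vertices x (L i)].

Definition triangle (V : finType) (e : rel V) (S : {set V}) : Prop :=
  #|S| = 3%N /\ {in S &, forall a b, a != b -> e a b}.

Definition transversal_triangle (V : finType) (e : rel V) (x y : V)
    (L : 'I_3 -> seq V) (S : {set V}) : Prop :=
  triangle e S /\ forall i, #|S :&: path_interior x y (L i)| = 1%N.

Definition theta_ring (V : finType) (e : rel V) : Prop :=
  forall (T : {set V}) (x y : V) (L : 'I_3 -> seq V),
    chorded_theta e T x y L -> exists S, transversal_triangle e x y L S.

(* Main.v *)
(** Let x, y be nonadjacent vertices joined by three walks with disjoint
    interiors A, B, W such that no edge joins A to B: when the walks are induced,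
    A and B close up to a hole, on which W is an ear attached at x and y.  Theta-ring
    graphs are the graphs without such an eared hole.  Indeed, follow two induced
    paths of a theta from x up to the first edge between them: unless this edge
    joins their first vertices, it closes a hole, and the rest of the theta
    contains an ear of that hole; so the three first vertices form a triangle.

    If there is no eared hole, then, as in Dirac's theorem on chordal graphs,
    every nonempty vertex set S has a vertex v which is simplicial in S, or has in S
    exactly two neighbours, nonadjacent and joined by a path in S - v.  The
    toric ideal is generated by the binomials of closed walks.  Adding a vertex v
    with d > 0 neighbours to S - v costs d - 1 more of these: the triangles given by
    the steps of a Hamiltonian path of the tournament on the neighbours, or the
    unique hole through v.  In total this makes q - n + r.

    Given an eared hole, order the vertices with the ear first, then x, y and the
    two sides of the hole, and orient every edge upwards.  The fibre of the binomial
    of the hole consists of its two monomials, so this binomial is, up to sign, one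
    of the generators.  But its exponent vector is a difference of exponent vectors
    of binomials whose degrees are differences of two vertices (the lower one lies on
    the ear), and these only involve the other generators.  So the exponent vectors
    of the q - n + r generators are dependent, although they span the cycle
    space, which has at least this dimension. *)
Require Import Defs.
From mathcomp Require Import ssrcomplements mpoly.
From mathcomp Require Import all_boot all_order all_algebra.
From mathcomp Require Import ring zify.
Set Implicit Arguments.
Unset Strict Implicit.
Unset Printing Implicit Defensive.
Import Order.TTheory GRing.Theory Num.Theory.

(** * Walks and eared holes *)

Lemma split_last (T : Type) (P : pred T) (s : seq T) : has P s ->
  exists s1 y s2, [/\ s = s1 ++ y :: s2, P y & ~~ has P s2].
Proof.
elim: s => //= x s IHs; case: (boolP (has P s)) => [/IHs[s1 [y [s2 [-> Py nP]]]] _|nP].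
  by exists (x :: s1), y, s2.
by rewrite orbF => Px; exists [::], x, s.
Qed.

Lemma split_first (T : Type) (P : pred T) (s : seq T) : has P s ->
  exists s1 y s2, [/\ s = s1 ++ y :: s2, P y & ~~ has P s1].
Proof.
by case/split_find=> y s1 s2 Py nP; exists s1, y, s2; rewrite cat_rcons.
Qed.

Lemma mem_split (T : finType) (u : T) (s : seq T) : u \in s ->
  exists s1 s2, s = s1 ++ u :: s2.
Proof. by case/path.splitPr=> s1 s2; exists s1, s2. Qed.

Section Walks.

Variables (V : finType) (e : rel V).
Hypothesis e_sym : symmetric e.
Implicit Types (x y z : V) (s p w : seq V) (A B C W S : {set V}).

(** Each entry is compared only with entries after its successor, so a repetition-free walk with
    this property is an induced path. *)
Fixpoint chordless s :=
  if s is x :: s' then all (fun z => ~~ e x z) (behead s') && chordless s'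
  else true.

(** Only the interior of the walk is recorded, and it may repeat vertices; [via_induced] turns it
    into an induced path. *)
Definition via A x y := exists2 w, path e x (rcons w y) & {subset w <= A}.

(* A, B and W may contain more vertices than the walks use, even x or y. *)
Definition eared_hole x y A B W : Prop :=
  [/\ x != y /\ ~~ e x y, [/\ via A x y, via B x y & via W x y],
      {in A & B, forall a b, a != b /\ ~~ e a b},
      [disjoint A & W] & [disjoint B & W]].

Lemma chordless_suffix s1 s2 : chordless (s1 ++ s2) -> chordless s2.
Proof. by elim: s1 => //= x s1 IHs /andP[_ /IHs]. Qed.

Lemma chordless_sep s1 z s2 a b :
  chordless (s1 ++ z :: s2) -> a \in s1 -> b \in s2 -> ~~ e a b.
Proof.
elim: s1 => //= x s1 IHs /andP[/allP H C]; rewrite inE => /predU1P[-> | a1] b2.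
  by apply: H; case: (s1) => //= u s; rewrite mem_cat inE b2 !orbT.
exact: IHs.
Qed.

Lemma path_suffix x s1 z s2 : path e x (s1 ++ z :: s2) -> path e z s2.
Proof. by rewrite cat_path /= => /and3P[]. Qed.

Lemma path_rev x w y : path e x (rcons w y) -> path e y (rcons (rev w) x).
Proof.
move=> p; rewrite -rev_cons -[y](last_rcons x w) -(belast_rcons x w y).
by rewrite rev_path; apply: sub_path p => a b; rewrite e_sym.
Qed.

Lemma via_seq w x y : path e x (rcons w y) -> via [set z in w] x y.
Proof. by exists w => // z; rewrite inE. Qed.

Lemma via_sub A B x y : A \subset B -> via A x y -> via B x y.
Proof. by move=> /subsetP sAB [w p sA]; exists w => // z /sA/sAB. Qed.

(** Prepend [x] to an induced path found for the rest of the walk: if [x] lies on that path, drop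
    everything before it; otherwise jump from [x] to its last neighbour on the path. *)
Lemma induced_subpath x p : path e x p -> exists q,
  [/\ path e x q, last x q = last x p, uniq (x :: q), chordless (x :: q)
    & {subset q <= p}].
Proof.
elim: p x => [x _|z p IHp x /= /andP[exz /IHp[q [pq lq uq cq sq]]]]; first by exists [::].
have ss : {subset z :: q <= z :: p}.
  by move=> u; rewrite !inE => /predU1P[-> | /sq->]; rewrite ?eqxx ?orbT.
case: (boolP (x \in z :: q)) => [/path.splitPr def|xNs].
  move: def; move Es : (z :: q) => s def; case: def Es => s1 s2 Es.
  have ls: last x s2 = last z p by rewrite -lq -[last z q]/(last z (z :: q)) Es last_cat.
  exists s2; split=> //.
  - by move: pq; case: s1 Es => [|u s1] [-> ->] //; apply: path_suffix.
  - by move: uq; rewrite Es cat_uniq => /and3P[].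
  - by move: cq; rewrite Es => /chordless_suffix.
  - by move=> u us; apply: ss; rewrite Es mem_cat inE us !orbT.
have : has (e x) (z :: q) by rewrite /= exz.
case/split_last=> s1 [y [s2 [Es exy nex]]].
have py : path e y s2 by move: pq; case: s1 Es => [|u s1] [-> ->] //; apply: path_suffix.
exists (y :: s2); split=> //=.
- by rewrite exy.
- by rewrite -lq -[last z q]/(last z (z :: q)) Es last_cat.
- move: uq xNs; rewrite Es cat_uniq mem_cat negb_or /= => /and3P[_ _ ->].
  by case/andP=> _ ->.
- by rewrite all_predC nex /=; move: cq; rewrite Es => /chordless_suffix.
- by move=> u us; apply: ss; rewrite Es mem_cat us orbT.
Qed.

Lemma induced_subwalk x w y : x != y -> path e x (rcons w y) -> exists w',
  [/\ path e x (rcons w' y), uniq (x :: rcons w' y), chordless (x :: rcons w' y)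
    & {subset w' <= w}].
Proof.
move=> xy /induced_subpath[q [pq]]; rewrite last_rcons.
case/lastP: q pq => [|q y'] pq; first by move=> /= E; rewrite E eqxx in xy.
rewrite last_rcons => E uq cq sq; rewrite {y'}E in pq uq cq sq; exists q; split=> // z zq.
have := sq z; rewrite !mem_rcons !inE zq orbT => /(_ isT) /predU1P[E|//].
by move: uq; rewrite /= rcons_uniq -E zq andbF.
Qed.

Lemma via_induced A x y : x != y -> via A x y -> exists w,
  [/\ path e x (rcons w y), uniq (x :: rcons w y), chordless (x :: rcons w y)
    & {subset w <= A}].
Proof.
move=> xy [w /(induced_subwalk xy)[w' [p u c s]] sA].
by exists w'; split=> // z /s/sA.
Qed.

End Walks.

Lemma uniq_count (T : eqType) (s : seq T) (z : T) : uniq s -> count_mem z s <= 1.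
Proof. by move=> u; rewrite count_uniq_mem // leq_b1. Qed.

(** Counting occurrences turns the many disjointness goals into linear arithmetic: the pieces come
    from one repetition-free sequence, in which every vertex counts at most once. *)
Lemma disjoint_seq (T : finType) (s1 s2 : seq T) :
  (forall z, count_mem z s1 + count_mem z s2 <= 1) ->
  [disjoint [set z in s1] & [set z in s2]].
Proof.
move=> H; rewrite disjoint_subset; apply/subsetP => z; rewrite !inE.
rewrite -!has_pred1 !has_count; have := H z; lia.
Qed.

Ltac count_lia :=
  rewrite /= -?cats1 ?(count_cat, count_rev) /= ?(count_cat, count_rev) /= ?eqxx /=;
  repeat match goal with
  | |- context [nat_of_bool ?b] => move: (nat_of_bool b) => ?
  | |- context [count ?p ?s] => move: (count p s) => ?
  end; clear; lia.
Ltac count_all U := let z := fresh "z" in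
  apply: disjoint_seq => z; have := U z; count_lia.

Lemma uniq_theta (T : eqType) (x y : T) s1 s2 s3 :
  uniq (x :: rcons s1 y) -> uniq (x :: rcons s2 y) -> uniq (x :: rcons s3 y) ->
  {in s1, forall u, u \notin s2} -> {in s1, forall u, u \notin s3} ->
  {in s2, forall u, u \notin s3} -> uniq (x :: y :: s1 ++ s2 ++ s3).
Proof.
rewrite !cons_uniq !rcons_uniq !mem_rcons !in_cons !negb_or.
move=> /and3P[/andP[xy x1] y1 u1] /and3P[/andP[_ x2] y2 u2] /and3P[/andP[_ x3] y3 u3].
move=> d12 d13 d23; rewrite !mem_cat !negb_or xy x1 x2 x3 y1 y2 y3 /=.
rewrite !cat_uniq u1 u2 u3 !andbT /=; apply/andP; split; apply/hasPn => z.
  by rewrite mem_cat => zs; apply/negP => z1; have := d12 z z1; have := d13 z z1;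
    case/orP: zs => ->.
by move=> z3; apply/negP => /d23; rewrite z3.
Qed.

(** * Theta-ring graphs and eared holes *)

Section ThetaRing.

Variables (V : finType) (e : rel V).
Hypothesis e_sym : symmetric e.
Implicit Types (x y z : V) (s p w : seq V) (A B C W S : {set V}).

Definition ear_free := forall x y A B W, ~ eared_hole e x y A B W.

(** Let [u] be the first vertex of [a :: s] with a neighbour in [b :: t], and [v] the first such
    neighbour. Unless [u] is [a] and [v] is [b], the theta up to the edge between them contains a
    hole, and the rest supplies an ear. *)
Lemma ear_free_heads x y a s b t w : ear_free -> ~~ e x y ->
  uniq (x :: y :: (a :: s) ++ (b :: t) ++ w) ->
  path e x (rcons (a :: s) y) -> chordless e (x :: rcons (a :: s) y) ->
  path e x (rcons (b :: t) y) -> chordless e (x :: rcons (b :: t) y) ->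
  path e x (rcons w y) -> e a b.
Proof.
move=> free nxy U ps cs pt ct pw.
have xy : x != y by move: U => /= /andP[]; rewrite inE negb_or => /andP[].
have {}U z := uniq_count z U.
case: (boolP (has (fun u => has (e u) (b :: t)) (a :: s))) => [|nn]; last first.
  (* No edge joins the two sides: the theta itself is an eared hole. *)
  case: (free x y [set z in a :: s] [set z in b :: t] [set z in w]); split=> //.
  - by split; apply: via_seq.
  - move=> u v; rewrite !(inE, mem_cat) -!in_cons => us vt.
    split; last by apply: contra nn => euv; apply/hasP; exists u => //; apply/hasP; exists v.
    apply/eqP => E; subst v; have := U u.
    have: 0 < count_mem u (a :: s) by rewrite -has_count has_pred1.
    have: 0 < count_mem u (b :: t) by rewrite -has_count has_pred1.
    count_lia.
  - count_all U.
  - count_all U.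
case/split_first => s1 [u [s2 [Es hu hs1]]].
case/split_first: hu => t1 [v [t2 [Et euv ht1]]].
rewrite Es Et in U ps cs pt ct hs1.
case: s1 Es U ps cs hs1 => [|a' s1] /= [Ea Es] U ps cs hs1.
  subst u s2; case: t1 Et U pt ct ht1 hs1 => [|b' t1] /= [Eb Et] U pt ct ht1 hs1.
    by subst v.
  subst b' t.
  (* Here [u] is [a] and [v] comes after [b]: the sides from [x] to [v] are [a] and [b :: t1], and
     the ear goes through [w] to [y] and back along [t2]. *)
  case: (free x v [set a] [set z in b :: t1] [set z in w ++ y :: rev t2]); split.
  - split.
      by apply/eqP => E; have := U x; subst v; count_lia.
    case/andP: ct => /allP H _.
    by apply: H; rewrite mem_rcons inE mem_cat inE eqxx !orbT.
  - split.
    + exists [:: a]; first by move: ps; rewrite /= euv andbT => /andP[->].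
      by move=> z; rewrite !inE.
    + apply: via_seq.
      by rewrite /= rcons_path; move: pt; rewrite rcons_cat cat_path /= => /and4P[-> -> -> _].
    + apply: via_seq.
      rewrite rcons_cat cat_path /=; move: pw; rewrite rcons_path => /andP[-> ->] /=.
      apply: path_rev => //; move: pt; rewrite rcons_cat /= => /andP[_].
      exact: path_suffix.
  - move=> i j; rewrite !inE => /eqP -> jt; split.
      apply/eqP => E; subst j; have := U a.
      have: 0 < count_mem a (b :: t1) by rewrite -has_count has_pred1 inE.
      count_lia.
    apply: contra ht1 => eaj; rewrite -[_ || _]/(has (e a) (b :: t1)).
    by apply/hasP; exists j; rewrite ?inE.
  - rewrite -[[set a]](_ : [set z in [:: a]] = _); last by apply/setP=> z; rewrite !inE.
    count_all U.
  - count_all U.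
subst a' s.
(* Here [u] comes after [a]: the sides from [x] to [u] are [a :: s1] and the second path up to [v];
   the ear goes through [w] to [y] and back along [s2]. *)
case: (free x u [set z in a :: s1] [set z in rcons t1 v] [set z in w ++ y :: rev s2]); split.
- split.
    by apply/eqP => E; have := U x; subst u; count_lia.
  case/andP: cs => /allP H _.
  by apply: H; rewrite mem_rcons inE mem_cat inE eqxx !orbT.
- split.
  + apply: via_seq.
    by rewrite /= rcons_path; move: ps; rewrite rcons_cat cat_path /= => /and4P[-> -> -> _].
  + apply: via_seq.
    rewrite rcons_path last_rcons e_sym euv andbT.
    by move: pt; rewrite rcons_cat /= cat_path rcons_path /= => /and3P[-> ->].
  + apply: via_seq.
    rewrite rcons_cat cat_path /=; move: pw; rewrite rcons_path => /andP[-> ->] /=.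
    apply: path_rev => //; move: ps; rewrite rcons_cat /= => /andP[_].
    exact: path_suffix.
- move=> i j; rewrite [i \in _]inE [j \in _]inE => is1 jt; split.
    apply/eqP => E; subst j; have := U i.
    have: 0 < count_mem i (a :: s1) by rewrite -has_count has_pred1.
    have: 0 < count_mem i (rcons t1 v) by rewrite -has_count has_pred1.
    count_lia.
  apply: contra hs1 => eij; rewrite -[_ || _]/(has _ (a :: s1)).
  apply/hasP; exists i => //; apply/hasP; exists j => //.
  by move: jt; rewrite mem_rcons mem_cat !inE => /orP[->|->]; rewrite ?orbT.
- count_all U.
- count_all U.
Qed.


Lemma path_interior_rcons x w y : uniq (x :: rcons w y) ->
  path_interior x y (rcons w y) = [set z in w].
Proof.
rewrite /= mem_rcons rcons_uniq inE negb_or => /and3P[/andP[_ xw] yw _].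
apply/setP=> z; rewrite /path_interior /path_vertices !inE mem_rcons inE.
case: (eqVneq z x) => [->|_]; rewrite ?(negbTE xw) //=.
by case: (eqVneq z y) => [->|_]; rewrite ?(negbTE yw).
Qed.

Lemma path_vertices_rcons x w y : uniq (x :: rcons w y) ->
  path_vertices x (rcons w y) = [set x; y] :|: [set z in w].
Proof.
move=> u; rewrite -(path_interior_rcons u) /path_interior /path_vertices.
apply/setP=> z; rewrite !inE mem_rcons inE.
by case: (z == x); case: (z == y).
Qed.

(** Replace each path by an induced one whose interior lies in the old interior. The first inner
    vertices of the three are pairwise adjacent by [ear_free_heads], and each lies on its own path
    only. *)
Lemma ear_free_theta_ring : ear_free -> theta_ring e.
Proof.
move=> free T x y L [[xy nxy] Lp Ld _].
have ind i : exists w, [/\ path e x (rcons w y), uniq (x :: rcons w y),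
    chordless e (x :: rcons w y) & {subset w <= path_interior x y (L i)}].
  case: (Lp i); case/lastP: (L i) => [_ /= E|w y' p].
    by rewrite E eqxx in xy.
  rewrite last_rcons => E u; subst y'.
  case: (induced_subwalk xy p) => w' [p' u' c' s']; exists w'; split=> // z /s'.
  by rewrite path_interior_rcons // inE.
have {ind} ind i : exists a, exists s, [/\ path e x (rcons (a :: s) y),
    uniq (x :: rcons (a :: s) y), chordless e (x :: rcons (a :: s) y)
    & {subset a :: s <= path_interior x y (L i)}].
  case: (ind i) => -[|a s] [p u c H]; last by exists a, s.
  by move: p; rewrite /= (negbTE nxy).
case: (fin_all_exists ind) => {ind} h /fin_all_exists[t ind].
have dis (i j : 'I_3) u : i != j -> u \in path_interior x y (L i) ->
    u \notin path_interior x y (L j).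
  have main (i' j' : 'I_3) : i' < j' -> u \in path_interior x y (L i') ->
      u \notin path_interior x y (L j').
    move=> ij; move: (Ld i' j' ij) => /setP/(_ u); rewrite !inE.
    by case: (_ || (u == y)) => //=; case: (_ || _) => //= ->.
  rewrite -val_eqE neq_ltn => /orP[/main|/main H ui] //.
  by apply/negP => /H/negP[].
have hin i : h i \in path_interior x y (L i).
  by case: (ind i) => _ _ _; apply; rewrite inE eqxx.
have dis' (i j : 'I_3) : i != j -> {in h i :: t i, forall u, u \notin h j :: t j}.
  move=> ij u ui; have [_ _ _ /(_ _ ui) ui'] := ind i.
  by apply: contra (dis _ _ _ ij ui') => uj; have [_ _ _ /(_ _ uj)] := ind j.
have adj (i j : 'I_3) : i != j -> e (h i) (h j).
  (* The third path [k] supplies the ear. *)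
  move=> ij; have [k ki kj] : exists2 k, k != i & k != j.
    have /card_gt0P[k] : 0 < #|~: [set i; j]|.
      by rewrite cardsCs setCK card_ord cards2 ij.
    by rewrite !inE negb_or => /andP[ki kj]; exists k.
  have [pi ui ci _] := ind i; have [pj uj cj _] := ind j; have [pk uk _ _] := ind k.
  by apply: (ear_free_heads free nxy _ pi ci pj cj pk); apply: uniq_theta => //;
    apply: dis'; rewrite // eq_sym.
exists [set h i | i in 'I_3].
have hinj : injective h.
  move=> i j E; apply/eqP/negPn/negP => ij.
  by have := dis' _ _ ij (h i) (mem_head _ _); rewrite E inE eqxx.
split; first split.
- by rewrite card_imset // card_ord.
- move=> _ _ /imsetP[i _ ->] /imsetP[j _ ->] ij; apply: adj.
  by apply: contra ij => /eqP ->.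
- move=> i; apply/eqP/cards1P; exists (h i); apply/setP => u; rewrite in_setI in_set1.
  apply/andP/eqP => [[/imsetP[j _ ->] hj]|->]; last by rewrite imset_f // hin.
  case: (eqVneq j i) => [-> //|/dis/(_ (hin j))]; by rewrite hj.
Qed.

(** A transversal triangle would contain an edge between the two sides of the hole. *)
Lemma theta_ring_ear_free : theta_ring e -> ear_free.
Proof.
move=> ring x y A B W [[xy nxy] [vA vB vW] anti dAW dBW].
case: (via_induced xy vA) => a [pa ua _ sa].
case: (via_induced xy vB) => b [pb ub _ sb].
case: (via_induced xy vW) => w [pw uw _ sw].
have dAB : [disjoint A & B].
  rewrite disjoint_subset; apply/subsetP => z zA; rewrite inE; apply/negP => zB.
  by have [] := anti z z zA zB; rewrite eqxx.
pose l := [:: a; b; w]; pose L (i : 'I_3) := rcons (nth [::] l i) y.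
have u i : uniq (x :: L i) by case: i => -[|[|[]]].
have pv i : path_vertices x (L i) = [set x; y] :|: [set z in nth [::] l i].
  exact: path_vertices_rcons (u i).
have dis (C D : {set V}) s t : [disjoint C & D] -> {subset s <= C} -> {subset t <= D} ->
    forall z, (z \in s) && (z \in t) = false.
  move=> dCD sC sD z; apply/negP => /andP[/sC zC /sD zD].
  by move: (disjointFr dCD zC); rewrite zD.
case: (ring (\bigcup_(i < 3) path_vertices x (L i)) x y L).
  split=> //.
  - by case=> -[|[|[]]] //= lt; split; rewrite ?last_rcons.
  - move=> i j ij; rewrite !pv -setUIr.
    apply/setUidPl/subsetP => z; rewrite !inE.
    have -> // : (z \in nth [::] l i) && (z \in nth [::] l j) = false.
    case: i j ij => -[|[|[]]] //= lti [[|[|[]]]] //= ltj _.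
    + exact: dis dAB sa sb z.
    + exact: dis dAW sa sw z.
    + exact: dis dBW sb sw z.
move=> S [[_ adj] tr].
have pick (i : 'I_3) : exists2 z, z \in S & z \in nth [::] l i.
  have /eqP/cards1P[z /setP/(_ z)] := tr i.
  by rewrite (path_interior_rcons (u i)) !inE eqxx => /andP[zS zi]; exists z.
case: (pick ord0) (pick (inord 1)) => z zS; rewrite /= => za [z' z'S].
rewrite inordK // => zb.
by have [zz' /negP[]] := anti _ _ (sa _ za) (sb _ zb); apply: adj.
Qed.

End ThetaRing.

(** * Simplicial vertices and corners *)

Section Elimination.

Variables (V : finType) (e : rel V).
Hypotheses (e_sym : symmetric e) (e_irr : irreflexive e).
Implicit Types (x y z w : V) (s p : seq V) (A B C W S : {set V}).

Definition restr S : rel V := [rel a b | [&& a \in S, b \in S & e a b]].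

Definition connected_set C := [forall a in C, forall b in C, connect (restr C) a b].

Definition nbrs S v := [set z in S | e v z].

Definition simplicial S v : Prop := {in nbrs S v &, forall a b, a != b -> e a b}.

Definition corner S v : Prop :=
  exists a b, [/\ nbrs S v = [set a; b], a != b, ~~ e a b & via e (S :\ v) a b].

Lemma nbrs_pair S v a b : nbrs S v = [set a; b] ->
  [/\ a \in S, b \in S, e v a & e v b].
Proof.
move=> N; have: a \in nbrs S v by rewrite N !inE eqxx.
have: b \in nbrs S v by rewrite N !inE eqxx orbT.
by rewrite !inE => /andP[-> ->] /andP[-> ->].
Qed.

Lemma restr_sym S : symmetric (restr S).
Proof. by move=> a b; rewrite /restr /= e_sym andbCA. Qed.

Lemma restr_connect_sym S a b : connect (restr S) a b = connect (restr S) b a.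
Proof. exact: sym_connect_sym (restr_sym S) a b. Qed.

Lemma connect_restrS A B a b :
  A \subset B -> connect (restr A) a b -> connect (restr B) a b.
Proof.
move=> /subsetP sAB; apply: connect_sub => u z /and3P[/sAB uB /sAB zB euz].
by apply: connect1; rewrite /restr /= uB zB.
Qed.

Lemma restr_path C a p : path (restr C) a p -> path e a p /\ {subset p <= C}.
Proof.
elim: p a => //= b p IHp a /andP[/and3P[_ bC ->] /IHp[-> sp]]; split=> // z.
by rewrite inE => /predU1P[-> //|/sp].
Qed.

Lemma connected_setU1 C w c : connected_set C -> c \in C -> e w c ->
  connected_set (w |: C).
Proof.
move=> /forall_inP conn cC ewc.
have toc a : a \in w |: C -> connect (restr (w |: C)) a c.
  case/setU1P=> [->|aC]; first by apply: connect1; rewrite /restr /= !inE eqxx cC orbT.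
  by apply: connect_restrS (subsetUr _ _) _; have /forall_inP := conn a aC; apply.
apply/forall_inP => a /toc ac; apply/forall_inP => b /toc.
by rewrite restr_connect_sym; apply: connect_trans.
Qed.

Lemma connected_via C x y a b : connected_set C -> a \in C -> b \in C ->
  e x a -> e b y -> via e C x y.
Proof.
move=> /forall_inP/(_ a) conn aC bC exa eby.
have /forall_inP/(_ b bC)/connectP[p /restr_path[pe sp] Eb] := conn aC.
exists (a :: p); first by rewrite /= exa rcons_path pe -Eb.
by move=> z; rewrite inE => /predU1P[-> //|/sp].
Qed.

Hypothesis free : ear_free e.

(* The vertex v and the connected set C without neighbours of v are chosen with
   #|C| maximal: then every vertex outside C and its neighbourhood N is adjacent to
   all of N, since otherwise C could be enlarged. *)
Lemma good_vertex S : S != set0 ->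
  exists2 v, v \in S & simplicial S v \/ corner S v.
Proof.
have [n] := ubnP #|S|; elim: n S => // n IHn S ltn /set0Pn[v0 v0S].
pose P C := [&& C != set0, C \subset S, connected_set C &
  [exists v in S :\: C, [forall c in C, ~~ e v c]]].
case: (pickP P) => [C0 PC0|noP]; last first.
  (* Without such a [C] the set [S] is a clique: for nonadjacent [a] and [b] one could take
     [[set b]], with [a] as the vertex outside. *)
  exists v0 => //; left => a b; rewrite !inE => /andP[aS _] /andP[bS _] ab.
  apply/negPn/negP => nab; have /negP[] := negbT (noP [set b]); apply/and4P; split.
  - by apply/set0Pn; exists b; rewrite inE.
  - by rewrite sub1set.
  - apply/forall_inP => u /set1P ->; apply/forall_inP => z /set1P ->; exact: connect0.
  - apply/exists_inP; exists a; first by rewrite !inE ab aS.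
    by apply/forall_inP => c /set1P ->.
case: (arg_maxnP (fun C => #|C|) PC0) =>
  C /and4P[C0' CS conn /exists_inP[v vSC /forall_inP vC]] maxC.
move: vSC; rewrite inE => /andP[vnC vS].
pose N := [set w in S :\: C | [exists c in C, e w c]].
have NP w : reflect [/\ w \in S, w \notin C & exists2 c, c \in C & e w c] (w \in N).
  rewrite inE in_setD -andbA.
  by apply: (iffP and3P) => [[wC wS /exists_inP]|[wS wC ex]]; split=> //; exact/exists_inP.
have nN u c : u \in S -> u \notin C -> u \notin N -> c \in C -> ~~ e u c.
  by move=> uS unC unN cC; apply: contra unN => euc; apply/NP; split=> //; exists c.
have full u w : u \in S -> u \notin C -> u \notin N -> w \in N -> e u w.
  move=> uS unC unN wN; have [wS wnC [c cC ewc]] := NP _ wN.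
  apply/negPn/negP => nuw; suff /maxC : P (w |: C).
    by rewrite cardsU1 wnC /= ltnn.
  apply/and4P; split.
  - by apply/set0Pn; exists w; rewrite setU11.
  - by rewrite subUset sub1set wS.
  - exact: connected_setU1 conn cC ewc.
  - apply/exists_inP; exists u.
      rewrite !inE negb_or unC uS !andbT.
      by apply: contra unN => /eqP ->.
    by apply/forall_inP => z /setU1P[->|/(nN _ _ uS unC unN)].
have vnN : v \notin N.
  by apply/NP => -[_ _ [c /vC/negP]].
case: (pickP (fun ab => [&& ab.1 \in N, ab.2 \in N, ab.1 != ab.2 & ~~ e ab.1 ab.2])).
  move=> [a b] /= /and4P[aN bN ab nab].
  have [aS anC [ca caC eaca]] := NP _ aN; have [bS bnC [cb cbC ebcb]] := NP _ bN.
  have eva : e v a by apply: full.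
  have evb : e v b by apply: full.
  have vab : via e C a b by apply: connected_via caC cbC eaca _; rewrite // e_sym.
  have [p [pp up cp sp]] := via_induced ab vab.
  (* The vertex [v] and the induced path from [a] to [b] in [C] form a hole. Any further vertex [u]
     outside [C] would yield an ear of it. *)
  have CE u : u \in S -> u \notin C -> u \in [:: v; a; b].
    move=> uS unC; rewrite !inE; apply/negPn/negP; rewrite !negb_or => /and3P[uv ua ub].
    case: (boolP (u \in N)) => uN; last first.
      (* Outside [N], the vertex [u] is adjacent to both [a] and [b] and is an ear by itself. *)
      apply: (free (x := a) (y := b) (A := [set z in p]) (B := [set v]) (W := [set u])).
      split=> //.
      + split; first exact: via_seq.
          exists [:: v]; last by move=> z; rewrite !inE.
          by rewrite /= e_sym eva evb.
        exists [:: u]; last by move=> z; rewrite !inE.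
        by rewrite /= e_sym !full.
      + move=> i j; rewrite !inE => /sp iC /eqP ->; split; last by rewrite e_sym; exact: vC.
        by apply: contra vnC => /eqP <-.
      + rewrite disjoints_subset; apply/subsetP => z; rewrite !inE => /sp zC.
        by apply: contra unC => /eqP <-.
      + by rewrite disjoints1 inE eq_sym.
    (* In [N], the vertex [u] is adjacent to [v] and has a neighbour in [C]. A walk through [C]
       takes it to a first vertex [z] of the path, which gives an ear between [v] and [z]. *)
    have [_ _ [c0 c0C euc0]] := NP _ uN.
    case: p pp up cp sp => [|p0 p]; first by rewrite /= (negbTE nab).
    set q := p0 :: p => pp up cp sp.
    have p0q : p0 \in q by rewrite inE eqxx.
    clearbody q; have p0C : p0 \in C by apply: sp.
    have /forall_inP/(_ c0 c0C)/forall_inP/(_ p0 p0C)/connectP[r /restr_path[re sr] Er] := conn.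
    have: has [in q] (c0 :: r).
      by apply/hasP; exists p0; rewrite // Er mem_last.
    case/split_first=> s1 [z [s2 [Es zq ns1]]].
    have ps1 : path e u (rcons s1 z).
      have: path e u (c0 :: r) by rewrite /= euc0.
      by rewrite Es -cat_rcons cat_path => /andP[].
    have sr' i : i \in s1 -> i \in C.
      move=> is1; have: i \in c0 :: r by rewrite Es mem_cat is1.
      by rewrite inE => /predU1P[->|/sr].
    have zC : z \in C by apply: sp.
    have [q1 [q2 Eq]] := mem_split zq.
    have usC : {in u :: s1, forall i, i \notin a :: b :: q}.
      move=> i; rewrite 3!in_cons => /predU1P[->|is1].
        rewrite (negbTE ua) (negbTE ub) /=; apply: contra unC; exact: sp.
      have iC := sr' _ is1; rewrite !negb_or; apply/and3P; split.
      + by apply: contra anC => /eqP <-.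
      + by apply: contra bnC => /eqP <-.
      + by apply: contra ns1 => iq; apply/hasP; exists i.
    apply: (free (x := v) (y := z) (A := [set i in a :: q1])
      (B := [set i in b :: rev q2]) (W := [set i in u :: s1])).
    split.
    + split; last exact: vC.
      by apply: contra vnC => /eqP ->.
    + split; apply: via_seq.
      * by rewrite /= eva; move: pp; rewrite Eq rcons_cat -cat_rcons cat_path => /andP[].
      * rewrite /= evb; apply: path_rev => //.
        by move: pp; rewrite Eq rcons_cat; apply: path_suffix.
      * by rewrite /= full.
    + have Eq' : a :: rcons q b = (a :: q1) ++ z :: rcons q2 b by rewrite Eq rcons_cat.
      rewrite Eq' in up cp => i j.
      rewrite ![_ \in [set _ in _]]inE => iq1 jq2.
      have jq2' : j \in rcons q2 b by rewrite mem_rcons; move: jq2; rewrite !inE mem_rev.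
      split; last exact: (chordless_sep cp iq1 jq2').
      apply/eqP => E; subst j; move: up; rewrite cat_uniq => /and3P[_ /hasPn/(_ i)].
      by rewrite inE jq2' orbT => /(_ isT); rewrite iq1.
    + rewrite disjoint_sym disjoints_subset; apply/subsetP => i; rewrite !inE -!in_cons.
      move=> /usC; apply: contra; rewrite Eq !inE mem_cat.
      by case/orP=> ->; rewrite ?orbT.
    + rewrite disjoint_sym disjoints_subset; apply/subsetP => i; rewrite !inE -!in_cons.
      move=> /usC; apply: contra; rewrite Eq !inE mem_cat mem_rev inE.
      by case/orP=> ->; rewrite ?orbT.
  exists v => //; right; exists a, b; split=> //.
    apply/setP=> z; rewrite !inE; apply/andP/orP => [[zS evz]|[/eqP->|/eqP->]] //.
    have /(CE _ zS) : z \notin C by apply/negP => /vC; rewrite evz.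
    by rewrite !inE => /or3P[/eqP E|->|->]; [move: evz; rewrite E e_irr | left | right].
  apply: via_sub vab; apply/subsetP => z zC; rewrite !inE (subsetP CS) // andbT.
  by apply: contra vnC => /eqP <-.
move=> clq.
have Nclique : {in N &, forall a b, a != b -> e a b}.
  move=> a b aN bN ab; apply/negPn/negP => nab.
  by have := clq (a, b); rewrite /= aN bN ab nab.
(* Now [N] is a clique completely joined to [R], and vertices of [R] have no neighbours in [C]; so a
   good vertex of the smaller set [R] can be transferred to [S]. *)
pose R := S :\: (C :|: N).
have RP u : reflect [/\ u \in S, u \notin C & u \notin N] (u \in R).
  by rewrite in_setD in_setU negb_or andbC; apply: (iffP and3P).
have cardR : #|R| < n.
  rewrite -ltnS (leq_trans _ ltn) // ltnS proper_card //.
  apply/properP; split; first exact: subsetDl.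
  have /set0Pn[c cC] := C0'; exists c; first exact: (subsetP CS).
  by apply/RP => -[_ /negP].
have R0 : R != set0 by apply/set0Pn; exists v; apply/RP.
have [u uR good] := IHn R cardR R0; have [uS unC unN] := RP _ uR.
have split_nbr a : a \in nbrs S u -> (a \in N) || (a \in nbrs R u).
  rewrite inE => /andP[aS eua].
  have anC : a \notin C by apply/negP => /(nN _ _ uS unC unN); rewrite eua.
  case: (boolP (a \in N)) => //= anN; rewrite inE eua andbT.
  exact/RP.
exists u => //; case: good => [simp|[a [b [Nu ab nab vab]]]].
  left=> a b /split_nbr/orP[aN|aR] /split_nbr/orP[bN|bR] ab.
  - exact: Nclique.
  - move: bR; rewrite inE => /andP[/RP[bS bnC bnN] _]; rewrite e_sym; exact: full.
  - move: aR; rewrite inE => /andP[/RP[aS anC anN] _]; exact: full.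
  - exact: simp.
(* A corner of [R] stays a corner if [N] is empty. Otherwise any [w] in [N] is adjacent to [a] and
   [b] and would be an ear of the hole through [u]. *)
case: (set_0Vmem N) => [N0|[w wN]].
  right; exists a, b; split=> //.
    apply/setP => z; apply/idP/idP => [/split_nbr|]; first by rewrite N0 inE /= Nu.
    by rewrite -Nu !inE => /andP[/andP[_ ->] ->].
  apply: via_sub vab; exact: setSD (subsetDl _ _).
have [p [pp up cp sp]] := via_induced ab vab.
have [/RP[aS anC anN] eua] : a \in R /\ e u a.
  by apply/andP; have: a \in nbrs R u; [rewrite Nu !inE eqxx|rewrite inE].
have [/RP[bS bnC bnN] eub] : b \in R /\ e u b.
  by apply/andP; have: b \in nbrs R u; [rewrite Nu !inE eqxx orbT|rewrite inE].
case: (free (x := a) (y := b) (A := [set z in p]) (B := [set u]) (W := [set w])); split=> //.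
- split; first exact: via_seq.
    exists [:: u]; last by move=> z; rewrite !inE.
    by rewrite /= e_sym eua eub.
  exists [:: w]; last by move=> z; rewrite !inE.
  by rewrite /= full //= e_sym full.
- move=> i j; rewrite !inE => ip /eqP ->.
  have := sp _ ip; rewrite in_setD1 => /andP[iu iR]; split=> //.
  apply/negP => eiu; have: i \in nbrs R u by rewrite inE iR e_sym.
  rewrite Nu => /set2P[] E; subst i; move: up.
    by rewrite /= mem_rcons inE ip orbT.
  by rewrite /= rcons_uniq ip andbF.
- rewrite disjoint_sym disjoints1 inE; apply/negP => /sp; rewrite in_setD1.
  by case/andP=> _ /RP[_ _ /negP].
- by rewrite disjoints1 inE; apply: contra unN => /eqP ->.
Qed.

End Elimination.

Section Separation.

Variables (V : finType) (e : rel V).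
Hypotheses (e_sym : symmetric e) (e_irr : irreflexive e) (free : ear_free e).
Implicit Types (x y z : V) (s p : seq V) (S : {set V}).

(** Take the last vertex of the walk in [A], then the first vertex of [B] after it. *)
Lemma cross x0 p (A B : seq V) :
  x0 \in A -> {in A, forall i, i \notin B} -> path e x0 p -> last x0 p \in B ->
  exists x y w, [/\ x \in A, y \in B, path e x (rcons w y), {subset w <= p}
    & {in w, forall i, (i \notin A) && (i \notin B)}].
Proof.
move=> x0A dis px lB.
have: has [in A] (x0 :: p) by rewrite /= x0A.
case/split_last=> s1 [x [s2 [Es xA ns2]]].
have ps2 : path e x s2.
  by case: s1 Es => [|u s1] [E1 E2]; move: px; rewrite E2 ?E1 //; apply: path_suffix.
have ss2 : {subset s2 <= p}.
  by case: s1 Es => [|u s1] [_ ->] z // zs; rewrite mem_cat inE zs !orbT.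
have El : last x0 p = last x s2.
  by rewrite -[last x0 p]/(last x0 (x0 :: p)) Es last_cat.
have: has [in B] s2.
  case: (s2) El => [|z t] El; first by move: lB; rewrite El (negbTE (dis _ xA)).
  by apply/hasP; exists (last x (z :: t)); [exact: (mem_last z t) | rewrite -El].
case/split_first=> w [y [t [Et yB nw]]].
exists x, y, w; split=> //.
- by move: ps2; rewrite Et -cat_rcons cat_path => /andP[].
- by move=> z zw; apply: ss2; rewrite Et mem_cat zw.
- move=> i iw; apply/andP; split; last by apply: contra nw => iB; apply/hasP; exists i.
  by apply: contra ns2 => iA; apply/hasP; exists i; rewrite // Et mem_cat iw.
Qed.

(** This makes the hole through a corner unique. If the walk missed [z], it would contain a segment
    crossing from the part of the induced path before [z] to the part after it. That segment is an
    ear of the hole, one side of which passes through [z] and the other through [v]. *)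
Lemma corner_separation S v a b q p :
  nbrs e S v = [set a; b] ->
  path e a (rcons q b) -> uniq (a :: rcons q b) -> chordless e (a :: rcons q b) ->
  {subset q <= S :\ v} ->
  path e a p -> last a p = b -> {subset p <= S :\ v} -> {subset q <= p}.
Proof.
move=> Nv pq uq cq sq pp lp sp z zq; apply/negPn/negP => znp.
have nbr u : u \in S -> e v u -> u = a \/ u = b.
  by move=> uS evu; apply/set2P; rewrite -Nv inE uS.
have [_ _ eva evb] := nbrs_pair Nv.
have [q1 [q2 Eq]] := mem_split zq.
have EQ : a :: rcons q b = (a :: q1) ++ z :: rcons q2 b by rewrite Eq rcons_cat.
have pQ : path e v (a :: rcons q b) by rewrite /= eva.
have u0 := uq; rewrite EQ in uq cq pQ.
have [|||x [y [w [xA yB pw sw nw]]]] := @cross a p (a :: q1) (rcons q2 b) _ _ pp _.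
- exact: mem_head.
- move=> i iA; apply/negP => iB; move: uq; rewrite cat_uniq => /and3P[_ /hasPn/(_ i)].
  by rewrite inE iB orbT iA => /(_ isT).
- by rewrite lp mem_rcons mem_head.
have nxy := chordless_sep cq xA yB.
have [A1 [A2 EA]] := mem_split xA.
have [B1 [B2 EB]] := mem_split yB.
have aA : a \in rcons A1 x.
  by case: A1 EA => [|u A1] [-> _]; rewrite ?mem_rcons ?inE ?eqxx ?orbT.
have bB : last y B2 = b by rewrite -[last y B2](last_cat z B1 (y :: B2)) -EB last_rcons.
rewrite EA EB in uq cq pQ nw.
have U : uniq (A1 ++ x :: (A2 ++ z :: B1) ++ y :: B2).
  by move: uq; rewrite -?catA /= -?catA /= -?catA /=.
have C1 : chordless e (A1 ++ x :: (A2 ++ z :: B1) ++ y :: B2).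
  by move: cq; rewrite -?catA /= -?catA /= -?catA /=.
have C2 : chordless e ((A1 ++ x :: A2 ++ z :: B1) ++ y :: B2).
  by move: cq; rewrite -?catA /= -?catA /= -?catA /=.
have PQ : path e v ((A1 ++ x :: A2 ++ z :: B1) ++ y :: B2).
  by move: pQ; rewrite -?catA /= -?catA /= -?catA /=.
have vS i : i \in (A1 ++ x :: A2) ++ z :: B1 ++ y :: B2 -> i != v.
  rewrite -EA -EB -EQ inE mem_rcons inE => /or3P[/eqP->|/eqP->|/sq].
  - by apply/eqP => E; move: eva; rewrite E e_irr.
  - by apply/eqP => E; move: evb; rewrite E e_irr.
  - by rewrite in_setD1 => /andP[].
have midS i : i \in A2 ++ z :: B1 -> i \in q.
  move=> im; have: i \in a :: rcons q b.
    by rewrite EQ EA EB; move: im; rewrite !(mem_cat, inE); case: (i \in A2); rewrite ?orbT //=;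
      case: (i == z); rewrite ?orbT //= => ->; rewrite ?orbT.
  rewrite inE mem_rcons inE => /or3P[/eqP E|/eqP E|//]; subst i; exfalso; move: U.
    rewrite -cat_rcons cat_uniq => /and3P[_ /hasPn/(_ a)].
    by rewrite mem_cat im aA => /(_ isT).
  rewrite -cat_cons catA cat_uniq => /and3P[_ /hasPn/(_ b)].
  by rewrite -bB mem_last mem_cat inE bB im !orbT => /(_ isT).
apply: (free (x := x) (y := y) (A := [set i in A2 ++ z :: B1])
   (B := [set i in rev A1 ++ v :: rev B2]) (W := [set i in w])).
split.
- split=> //; apply/eqP => E; subst y; have := uniq_count x U.
  count_lia.
- have vx : path e v (rcons A1 x).
    by move: PQ; rewrite -catA cat_cons -cat_rcons cat_path => /andP[].
  have vy : path e y (rcons B2 v).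
    by rewrite rcons_path bB e_sym evb andbT; apply: path_suffix PQ.
  split; apply: via_seq => //.
    move: PQ; rewrite -catA cat_cons -cat_rcons cat_path last_rcons => /andP[_].
    by rewrite -cat_rcons cat_path => /andP[].
  rewrite rcons_cat /= -cat_rcons cat_path (path_rev e_sym vx) last_rcons.
  exact: path_rev.
- move=> i j; rewrite [i \in _]inE => im.
  rewrite inE mem_cat inE !mem_rev => jm; split.
    apply/eqP => E; subst j; case/or3P: jm => [iA|/eqP E|iB].
    + move: U; rewrite -cat_rcons cat_uniq => /and3P[_ /hasPn/(_ i)].
      by rewrite mem_cat im mem_rcons inE iA orbT => /(_ isT).
    + by have := sq _ (midS _ im); rewrite E !inE eqxx.
    + move: U; rewrite -cat_cons catA cat_uniq => /and3P[_ /hasPn/(_ i)].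
      by rewrite mem_cat !inE iB im !orbT => /(_ isT).
  case/or3P: jm => [jA|/eqP->|jB].
  + by rewrite e_sym; apply: (chordless_sep C1 jA); rewrite mem_cat im.
  + have := sq _ (midS _ im); rewrite in_setD1 => /andP[iv iS].
    apply/negP; rewrite e_sym => /(nbr _ iS) [] E; subst i.
      by move: u0; rewrite /= mem_rcons inE (midS _ im) orbT.
    by move: u0; rewrite /= rcons_uniq (midS _ im) andbF.
  + by apply: (chordless_sep C2 _ jB); rewrite mem_cat inE im !orbT.
- rewrite disjoint_sym disjoints_subset; apply/subsetP => i; rewrite !inE => iw.
  apply/negP; rewrite mem_cat inE => im; have /andP[] := nw _ iw.
  rewrite !mem_cat !inE; case/or3P: im => [->|/eqP Ez|->]; rewrite ?orbT //.
  by move: (sw _ iw); rewrite Ez (negbTE znp).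
- rewrite disjoint_sym disjoints_subset; apply/subsetP => i; rewrite !inE => iw.
  apply/negP; rewrite mem_cat inE !mem_rev => im; have /andP[] := nw _ iw.
  rewrite !mem_cat !inE; case/or3P: im => [->|/eqP Ez|->]; rewrite ?orbT //.
  by move: (sp _ (sw _ iw)); rewrite Ez !inE eqxx.
Qed.

End Separation.

(** * Closed walks modulo an ideal *)

Section WalkProducts.
Local Open Scope ring_scope.

Variables (V : finType) (R : comNzRingType) (F : V -> V -> R).
Implicit Types (x y z : V) (p q : seq V).

Fixpoint fw x p : R := if p is y :: p' then F x y * fw y p' else 1.
Fixpoint bw x p : R := if p is y :: p' then F y x * bw y p' else 1.

Lemma fw_cat x p q : fw x (p ++ q) = fw x p * fw (last x p) q.
Proof. by elim: p x => [|y p IHp] x /=; rewrite ?mul1r // IHp mulrA. Qed.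

Lemma bw_cat x p q : bw x (p ++ q) = bw x p * bw (last x p) q.
Proof. by elim: p x => [|y p IHp] x /=; rewrite ?mul1r // IHp mulrA. Qed.

Lemma fw_rcons x p y : fw x (rcons p y) = fw x p * F (last x p) y.
Proof. by rewrite -cats1 fw_cat /= mulr1. Qed.

Lemma bw_rcons x p y : bw x (rcons p y) = bw x p * F y (last x p).
Proof. by rewrite -cats1 bw_cat /= mulr1. Qed.

Lemma fw_rev x p y : fw y (rcons (rev p) x) = bw x (rcons p y).
Proof.
elim: p x => [|z p IHp] x //=.
by rewrite rev_cons fw_rcons last_rcons IHp mulrC.
Qed.

Lemma bw_rev x p y : bw y (rcons (rev p) x) = fw x (rcons p y).
Proof.
elim: p x => [|z p IHp] x //=.
by rewrite rev_cons bw_rcons last_rcons IHp mulrC.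
Qed.

End WalkProducts.

Section Balance.
Local Open Scope ring_scope.

Variables (V : finType) (e : rel V).
Hypotheses (e_sym : symmetric e) (e_irr : irreflexive e).
Variables (R : comNzRingType) (F : V -> V -> R) (J : R -> Prop).
Hypothesis F1 : forall x y, F x y = 1 \/ F y x = 1.
Hypothesis J0 : J 0.
Hypothesis JD : forall a b, J a -> J b -> J (a + b).
Hypothesis JM : forall r a, J a -> J (r * a).
Implicit Types (x y z v : V) (p q s : seq V) (S : {set V}).

Local Notation fw := (fw F).
Local Notation bw := (bw F).

(* For F the step monomials of an orientation, F x y is the variable of the arc
   (x, y), or 1 if the edge is oriented from y to x; so this says that the binomial of
   the closed walk x :: p lies in J. *)
Definition balanced x p := J (fw x p - bw x p).

Definition all_balanced S :=
  forall x p, path (restr e S) x p -> last x p = x -> balanced x p.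

Lemma ideal_comb (r a s b t : R) : J a -> J b -> t = r * a + s * b -> J t.
Proof. by move=> Ja Jb ->; apply: JD; apply: JM. Qed.

Lemma ideal_eq a b : a = b -> J a -> J b.
Proof. by move->. Qed.

Lemma ideal_opp a : J a -> J (- a).
Proof. by move=> Ja; rewrite -mulN1r; apply: JM. Qed.

(* Xp, Xn and rp, rn are the two products along two arcs of a closed walk, and
   f, g are the two values of a chord closing both arcs. *)
Lemma chord_balance (Xp Xn rp rn f g : R) : f = 1 \/ g = 1 ->
  J (Xp * g - Xn * f) -> J (f * rp - g * rn) -> J (Xp * rp - Xn * rn).
Proof.
case=> -> JX Jr.
  by apply: (ideal_comb (r := Xp) (s := rn) Jr JX); ring.
by apply: (ideal_comb (r := rp) (s := Xn) JX Jr); ring.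
Qed.

(** Inserts a closed detour, by [f g h - f' g' h' = f h (g - g') + g' (f h - f' h')]. *)
Lemma balanced_splice x y p q (r : seq V) : y = last x p -> balanced y q -> last y q = y ->
  balanced x (p ++ r) -> balanced x (p ++ q ++ r).
Proof.
move=> Ey bq lq br; rewrite /balanced !(fw_cat, bw_cat) -Ey lq.
move: br; rewrite /balanced fw_cat bw_cat -Ey => br.
apply: (ideal_comb (r := fw x p * fw y r) (s := bw y q) bq br); ring.
Qed.

Lemma balanced_rotate x p q : last x (p ++ q) = x ->
  balanced (last x p) (q ++ p) -> balanced x (p ++ q).
Proof.
rewrite last_cat => lx; rewrite /balanced !(fw_cat, bw_cat) lx.
by rewrite (mulrC (fw x p)) (mulrC (bw x p)).
Qed.

Lemma balanced_rev x p : balanced x (rcons p x) -> balanced x (rcons (rev p) x).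
Proof. by rewrite /balanced fw_rev bw_rev => /ideal_opp; rewrite opprB. Qed.

(** A closed walk through [v] is rotated to start at [v] and cut at its returns to [v]; between two
    returns it is an excursion into [S], covered by the last hypothesis. *)
Lemma all_balanced_setU1 v S : v \notin S -> all_balanced S ->
  (forall a q, a \in nbrs e S v -> path (restr e S) a q ->
     last a q \in nbrs e S v -> balanced v (a :: rcons q v)) ->
  all_balanced (v |: S).
Proof.
move=> vS bS exc.
have restrU a b : restr e (v |: S) a b -> a != v -> b != v -> restr e S a b.
  by rewrite /restr /= !inE => /and3P[aS bS' ->] /negbTE av /negbTE bv; move: aS bS';
    rewrite av bv => /= -> ->.
have avoid x p : path (restr e (v |: S)) x p -> v \notin x :: p -> path (restr e S) x p.
  elim: p x => //= y p IHp x /andP[exy py].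
  rewrite !inE !negb_or => /and3P[xv yv vp]; rewrite restrU 1?eq_sym //= IHp //.
  by rewrite inE negb_or yv.
have from_v n : forall p, (size p < n)%N -> path (restr e (v |: S)) v p ->
    last v p = v -> balanced v p.
  elim: n => // n IHn [_ _ _|a p]; first by rewrite /balanced subrr.
  rewrite ltnS => ltn pp lv; have: has (pred1 v) (a :: p).
    by apply/hasP; exists v; [rewrite -{1}lv /= mem_last | exact: eqxx].
  case/split_first => q [v' [r [Eq /= /eqP Ev nq]]]; subst v'.
  have nvq : v \notin q by apply: contra nq => vq; apply/hasP; exists v => //=.
  have pr : path (restr e (v |: S)) v r by move: pp; rewrite Eq; apply: path_suffix.
  have lr : last v r = v by rewrite -[LHS](last_cat v q (v :: r)) -Eq.
  have br : balanced v r.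
    apply: IHn => //; apply: leq_trans ltn.
    by rewrite Eq size_cat /=; lia.
  have pq : path (restr e (v |: S)) v (rcons q v).
    by move: pp; rewrite Eq -cat_rcons cat_path => /andP[].
  suff bq : balanced v (rcons q v).
    rewrite Eq -cat_rcons -[rcons q v ++ r]cat0s.
    by apply: (balanced_splice (y := v)); rewrite ?last_rcons.
  case: q nvq {Eq nq} pq => [|b q].
    by rewrite /= /restr /= e_irr !andbF.
  move=> nvq /= /andP[evb pq]; apply: exc.
  - move: evb; rewrite /restr /= => /and3P[_]; rewrite !inE => /predU1P[E|bS' evb].
      by move: nvq; rewrite E inE eqxx.
    by rewrite bS' evb.
  - apply: avoid nvq; move: pq; rewrite rcons_path; by case/andP.
  - move: pq; rewrite rcons_path => /andP[_]; rewrite /restr /= => /and3P[lS _ elv].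
    rewrite inE e_sym elv andbT; move: lS; rewrite in_setU1 => /predU1P[E|//].
    by move: nvq; rewrite -E mem_last.
move=> x p px lx; case: (boolP (v \in x :: p)) => [|vp]; last by apply: bS => //; exact: avoid.
rewrite inE => /predU1P[E|vp]; first by subst x; exact: from_v px lx.
have [p1 [p2 Ep]] := mem_split vp; rewrite -cat_rcons in Ep.
rewrite Ep in px lx *; apply: balanced_rotate => //; rewrite last_rcons.
apply: (@from_v (size (p2 ++ rcons p1 v)).+1) => //; last by rewrite last_cat last_rcons.
move: px lx; rewrite last_cat !cat_path last_rcons => /andP[px1 px2] lx.
by rewrite px2 lx.
Qed.

(** Replaces a segment [X] by its chord. A general ideal does not allow cancelling the monomial of
    the chord, but one of its two directions has value 1, so [chord_balance] applies. *)
Lemma balanced_shortcut x p X (r : seq V) : let u := last x p in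
  let u' := last u X in balanced u (rcons X u) ->
  balanced x (p ++ u' :: r) -> balanced x (p ++ X ++ r).
Proof.
move=> u u' bX br; move: bX br; rewrite /balanced !(fw_cat, bw_cat) !(fw_rcons, bw_rcons) /=.
rewrite -/u -/u' => bX br.
suff H : J (F u u' * (fw x p * fw u' r) - F u' u * (bw x p * bw u' r)).
  by apply: ideal_eq (chord_balance (F1 u u') bX H); ring.
by apply: ideal_eq br; ring.
Qed.

Lemma balanced_closed_ear v a q (S : {set V}) : all_balanced S ->
  path (restr e S) a q -> last a q = a -> balanced v (a :: rcons q v).
Proof.
move=> bS pq lq; rewrite -cat1s -cats1; apply: (balanced_splice (y := a)) => //.
  exact: bS.
by rewrite /balanced /= !mulr1 mulrC subrr.
Qed.

Section Simplicial.
Local Open Scope ring_scope.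

Variables (arc : rel V) (v : V) (S : {set V}) (s : seq V).
Hypothesis arcF : forall a b, arc a b -> F b a = 1.
Hypothesis arc_s : sorted arc s.
Hypothesis s_nbrs : s =i nbrs e S v.
Hypothesis simp : simplicial e S v.
Hypothesis us : uniq s.
Hypothesis tri : forall s1 a b s2, s = s1 ++ a :: b :: s2 -> balanced v [:: a; b; v].

(** The triangles over consecutive entries of [s] are glued along the chords from [v]. Since [s]
    follows the arcs, the backward product along it is 1. *)
Lemma fan s1 a p s2 : s = s1 ++ a :: p ++ s2 ->
  bw a p = 1 /\ balanced v (a :: rcons p v).
Proof.
elim: p s1 a => [|b p IHp] s1 a Es.
  by split=> //; rewrite /balanced /= !mulr1 mulrC subrr.
have [|b1 b2] := IHp (rcons s1 a) b; first by rewrite cat_rcons.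
have Fba : F b a = 1.
  by apply: arcF; move: arc_s; rewrite Es => /cat_sorted2[_] /= /andP[].
have b3 := tri Es; rewrite /= Fba b1 mul1r; split=> //.
have := @chord_balance (F v a * F a b) (F a v * F b a)
   (fw b p * F (last b p) v) (bw b p * F v (last b p)) (F v b) (F b v) (F1 _ _).
move: b2 b3; rewrite /balanced /= !fw_rcons !bw_rcons !mulr1 !mulrA => b2 b3 /(_ b3 b2).
by [].
Qed.

(** Between two neighbours the fan along [s] and the closed walk in [S] along [s] and back over the
    edge have the same forward product along [s]. It is eliminated without any division, because the
    backward product is 1; this is what the Hamiltonian path is for. *)
Lemma simplicial_triangle a b : all_balanced S -> a \in nbrs e S v ->
  b \in nbrs e S v -> a != b -> balanced v [:: a; b; v].
Proof.
move=> bS; rewrite -!s_nbrs => aS bS' ab.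
have main a' b' s1 t s2 : s = s1 ++ a' :: t ++ b' :: s2 -> balanced v [:: a'; b'; v].
  move=> Es; have [|b1 b2] := @fan s1 a' (rcons t b') s2; first by rewrite cat_rcons.
  have ins z : z \in a' :: rcons t b' -> z \in nbrs e S v.
    rewrite -s_nbrs Es !(mem_cat, inE, mem_rcons).
    by case/or3P=> ->; rewrite ?orbT.
  have inS z : z \in a' :: rcons t b' -> z \in S by move=> /ins; rewrite inE => /andP[].
  have a'b' : a' != b'.
    move: us; rewrite Es cat_uniq => /and3P[_ _ /=/andP[]].
    by rewrite mem_cat inE !negb_or => /and3P[].
  have ea'b' : e a' b' by apply: simp; rewrite ?ins // !inE ?mem_rcons ?inE eqxx ?orbT.
  have pt : path (restr e S) a' (rcons t b').
    have: path arc a' (rcons t b').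
      move: arc_s; rewrite Es => /cat_sorted2[_] /=.
      by rewrite -cat_rcons cat_path => /andP[].
    have: uniq (a' :: rcons t b').
      move: us; rewrite Es cat_uniq => /and3P[_ _].
      by rewrite -cat_rcons -cat_cons cat_uniq => /and3P[].
    move: ins inS; elim: (rcons t b') a' {Es ea'b' a'b' b1 b2} => //= c p IHp d ins inS.
    rewrite inE negb_or => /andP[/andP[dc _] up] /andP[adc pp].
    rewrite IHp // /restr /= ?inS ?simp ?ins ?inE ?eqxx ?orbT //.
      by move=> z zp; apply: ins; rewrite inE zp orbT.
    by move=> z zp; apply: inS; rewrite inE zp orbT.
  have := bS a' (rcons (rcons t b') a'); rewrite rcons_path pt !last_rcons.
  rewrite /restr /= e_sym ea'b' !inS ?inE ?mem_rcons ?inE ?eqxx ?orbT // => /(_ isT erefl).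
  move: b2; rewrite /balanced /= !fw_rcons !bw_rcons !last_rcons -bw_rcons b1 /= => b2 b3.
  by apply: (ideal_comb (r := F b' a') (s := - (F v a' * F b' v)) b2 b3); ring.
have [s1 [s2 Es]] := mem_split aS.
move: bS'; rewrite Es mem_cat inE eq_sym (negbTE ab) /= => /orP[b1|b2].
  have [t1 [t2 Et]] := mem_split b1.
  have /balanced_rev : balanced v (rcons [:: b; a] v).
    by apply: (main b a t1 t2 s2); rewrite Es Et -catA.
  by [].
have [t1 [t2 Et]] := mem_split b2.
by apply: (main a b s1 t1 t2); rewrite Es Et.
Qed.

(** The edge between the two ends shortens an excursion from [v] to a triangle at [v]. *)
Lemma simplicial_all_balanced : v \notin S -> all_balanced S -> all_balanced (v |: S).
Proof.
move=> vS bS; apply: all_balanced_setU1 => // a q aN pq bN.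
case: (eqVneq (last a q) a) => [lq|ba]; first exact: balanced_closed_ear pq lq.
rewrite -cat1s -cats1; apply: balanced_shortcut => /=.
  apply: bS; last by rewrite last_rcons.
  rewrite rcons_path pq /restr /= simp // andbT.
  by move: aN bN; rewrite !inE => /andP[-> _] /andP[-> _].
by apply: simplicial_triangle => //; rewrite eq_sym.
Qed.

End Simplicial.

Section Corner.
Local Open Scope ring_scope.

Hypothesis free : ear_free e.
Variables (v a b : V) (S : {set V}) (q : seq V).
Hypotheses (vS : v \notin S) (Nv : nbrs e S v = [set a; b]).
Hypotheses (pq : path e a (rcons q b)) (uq : uniq (a :: rcons q b)).
Hypotheses (cq : chordless e (a :: rcons q b)) (sq : {subset q <= S}).
Hypothesis gen : balanced v (a :: rcons (rcons q b) v).

Let SDv : S :\ v = S.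
Proof. by apply/setDidPl; rewrite disjoint_sym disjoints1. Qed.

(** Induction along the induced path: [s] and [u] already follow it, while [p] is arbitrary. By
    [corner_separation] the next path vertex [u'] lies on [p], and the part of [p] up to it is
    shortened to the edge from [u] to [u']. At [b] only a closed detour remains. *)
Lemma corner_walk t s u p : all_balanced S -> a :: rcons q b = s ++ u :: t ->
  path (restr e S) u p -> last u p = b -> balanced v (s ++ u :: rcons p v).
Proof.
have [aS bS eva evb] := nbrs_pair Nv; move=> bal.
have inS z : z \in a :: rcons q b -> z \in S.
  by rewrite inE mem_rcons inE => /or3P[/eqP->|/eqP->|/sq].
elim: t s u p => [|u' t IHt] s u p Eq pp lp.
  have Eu : u = b by rewrite -[u](last_cat v s [:: u]) -Eq /= last_rcons.
  subst u; rewrite -cat1s catA -cats1; apply: (balanced_splice (y := b)) => //.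
  - by rewrite last_cat.
  - exact: bal.
  - by rewrite -Eq cats1.
have Eq' : a :: rcons q b = rcons s u ++ u' :: t by rewrite cat_rcons.
have [su' uu'] : u' \notin rcons s u /\ u != u'.
  move: uq; rewrite Eq' cat_uniq => /and3P[_ /hasPn/(_ u') + _].
  rewrite mem_head => /(_ isT) nu; split=> //.
  by apply: contra nu => /eqP <-; rewrite mem_rcons mem_head.
have euu' : e u u'.
  have: path e v (a :: rcons q b) by rewrite /= eva.
  by rewrite Eq cat_path /= => /and4P[].
have u'p : u' \in p.
  have: u' \in a :: rcons q b by rewrite Eq' mem_cat mem_head orbT.
  have [s' Es'] : exists s', rcons s u = a :: s'.
    by case: (s) Eq' => [|c s1] /= [-> _]; [exists [::] | exists (rcons s1 u)].
  rewrite inE mem_rcons inE => /or3P[/eqP E|/eqP E|u'q].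
  - by move: su'; rewrite Es' E mem_head.
  - case: (p) lp => [|c p'] /= lp; first by rewrite E -lp eqxx in uu'.
    by rewrite E -lp mem_last.
  - have: u' \in s' ++ p; last first.
      rewrite mem_cat => /orP[u's|//].
      by move: su'; rewrite Es' inE u's orbT.
    have ls : last a s' = u by rewrite -[LHS]/(last a (a :: s')) -Es' last_rcons.
    have [ppe pS] := restr_path pp.
    apply: (corner_separation e_sym e_irr free Nv pq uq cq _ _ _ _ u'q).
    + by rewrite SDv.
    + move: pq; rewrite cat_path ls ppe andbT.
      have: path e v (a :: rcons q b) -> path e a s'.
        by rewrite Eq' Es' cat_path => /andP[/= /andP[]].
      by move=> H pq'; apply: H; rewrite /= eva.
    + by rewrite last_cat ls.
    + move=> z; rewrite SDv mem_cat => /orP[zs|/pS //].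
      by apply: inS; rewrite Eq' Es' mem_cat inE zs orbT.
have [p1 [p2 Ep]] := mem_split u'p; rewrite -cat_rcons in Ep.
move: pp lp; rewrite Ep last_cat last_rcons cat_path last_rcons => /andP[pp1 pp2] lp.
have := IHt _ _ _ Eq' pp2 lp.
move=> br; rewrite rcons_cat -cat_rcons; apply: balanced_shortcut; rewrite !last_rcons //.
apply: bal; last by rewrite last_rcons.
rewrite rcons_path pp1 last_rcons /restr /= e_sym euu' andbT.
by rewrite !inS // Eq mem_cat !inE eqxx ?orbT.
Qed.

Lemma corner_all_balanced : all_balanced S -> all_balanced (v |: S).
Proof.
move=> bal; apply: all_balanced_setU1 => // c r.
have ab (r' : seq V) : path (restr e S) a r' -> last a r' = b ->
    balanced v (a :: rcons r' v).
  by move=> pr lr; apply: (@corner_walk (rcons q b) [::]).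
rewrite Nv => /set2P[] -> pr /set2P[] lr.
- exact: balanced_closed_ear pr lr.
- exact: ab.
- rewrite -rcons_cons -[b :: r]revK; apply: balanced_rev.
  rewrite lastI lr rev_rcons rcons_cons; apply: ab.
    rewrite -lr rev_path; apply: sub_path pr => x y; rewrite restr_sym //.
  by case: (r) lr => [|d r'] //= _; rewrite rev_cons last_rcons.
- exact: balanced_closed_ear pr lr.
Qed.

End Corner.

End Balance.

(** * Generating closed walks along an elimination order *)

Lemma mem_zip_behead (T : eqType) (s1 : seq T) a b s2 (s := s1 ++ a :: b :: s2) :
  (a, b) \in zip s (behead s).
Proof.
rewrite {}/s; elim: s1 => [|c s1 IHs] /=; first exact: mem_head.
by case: s1 IHs => [|d s1] /= IHs; rewrite inE IHs orbT.
Qed.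

Lemma zip_behead_sub (T : eqType) (r : rel T) (s : seq T) a b : sorted r s ->
  (a, b) \in zip s (behead s) -> [/\ a \in s, b \in s & r a b].
Proof.
case: s => //= x s; elim: s x => //= y s IHs x /andP[rxy ps].
rewrite inE => /orP[/eqP[-> ->]|/(IHs _ ps)[a1 b1 ->]]; first by rewrite !inE !eqxx !orbT.
by split=> //; [rewrite a1 orbT | rewrite in_cons b1 orbT].
Qed.

Section Generators.

Variables (V : finType) (e : rel V).
Hypotheses (e_sym : symmetric e) (e_irr : irreflexive e).
Variable D : {set V * V}.
Hypothesis oD : orientation e D.
Implicit Types (x y z v : V) (p q s : seq V) (S Z : {set V}).

Lemma nbrs_setU1 v S : nbrs e (v |: S) v = nbrs e S v.
Proof.
by apply/setP=> z; rewrite !inE; case: eqP => [->|]; rewrite ?e_irr ?andbF.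
Qed.

(** Adding [v] merges no components if its neighbours are already connected: retract [v] onto a
    neighbour [a0]. *)
Lemma connect_setU1 v S z z' : v \notin S -> nbrs e S v != set0 ->
  {in nbrs e S v &, forall a b, connect (restr e S) a b} ->
  z \in S -> z' \in S -> connect (restr e (v |: S)) z z' -> connect (restr e S) z z'.
Proof.
move=> vS /set0Pn[a0 a0N] conn zS z'S /connectP[p].
pose f u := if u == v then a0 else u.
have fE u : u \in S -> f u = u by rewrite /f; case: eqP => // -> /(negP vS).
have step x y : restr e (v |: S) x y -> connect (restr e S) (f x) (f y).
  rewrite /restr /= !inE => /and3P[xS yS exy]; rewrite /f.
  case: eqP xS => [xv _|_ /= xS].
    case: eqP yS => [_ _|_ /= yS]; first exact: connect0.
    by apply: conn => //; rewrite inE yS -xv.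
  case: eqP yS => [yv _|_ /= yS]; last by apply: connect1; rewrite /restr /= xS yS.
  by apply: conn => //; rewrite inE xS -yv e_sym.
move=> pp Ez; rewrite -(fE z zS) -(fE z' z'S) Ez.
elim: p z {zS Ez} pp => [|y p IHp] x /=; first by rewrite connect0.
by case/andP=> /step xy /IHp; apply: connect_trans.
Qed.

Definition arcs_in S := [set a in D | (a.1 \in S) && (a.2 \in S)].

Lemma arcs_in_setU1 v S : v \notin S ->
  #|arcs_in S| + #|nbrs e S v| <= #|arcs_in (v |: S)|.
Proof.
move=> vS; pose g z := if (v, z) \in D then (v, z) else (z, v).
have gP z : (g z == (v, z)) || (g z == (z, v)).
  by rewrite /g; case: ifP; rewrite eqxx ?orbT.
have ginj : injective g.
  move=> x y; rewrite /g; case: ifP => _; case: ifP => _ [] //; first by move=> -> ->.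
  by move=> -> ->.
rewrite -(card_imset _ ginj) -cardsUI.
have -> : arcs_in S :&: g @: nbrs e S v = set0.
  apply/setP=> a; rewrite !inE; apply/negP => /andP[/andP[_ /andP[a1 a2]] /imsetP[z _ E]].
  by have := gP z; rewrite -E => /orP[] /eqP Ea; move: a1 a2; rewrite Ea /= (negbTE vS).
rewrite cards0 addn0; apply/subset_leq_card/subsetP => a /setUP[|/imsetP[z]].
  by rewrite !inE => /and3P[-> -> ->]; rewrite !orbT.
rewrite inE => /andP[zS evz] ->; have := evz; rewrite (proj1 oD) inE /g => H.
by case: ifP => [Dvz|nD]; rewrite ?Dvz /= !inE eqxx zS ?orbT // andbT; move: H; rewrite nD.
Qed.

Definition is_ideal (R : comNzRingType) (J : R -> Prop) :=
  [/\ J 0%R, forall a b, J a -> J b -> J (a + b)%R & forall r a, J a -> J (r * a)%R].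

Hypothesis free : ear_free e.

(* The vertices of Z lie in distinct components of S, so at the end #|Z| is at most
   the number of components of the graph; the components of S are never counted. *)
Lemma closed_walk_generators S :
  exists (gs : seq (V * seq V)) (Z : {set V}),
  [/\ {in gs, forall g, path e g.1 g.2 /\ last g.1 g.2 = g.1},
      size gs + #|S| <= #|arcs_in S| + #|Z|,
      Z \subset S /\ {in Z &, forall z z', connect (restr e S) z z' -> z = z'}
    & forall (R : comNzRingType) (F : V -> V -> R) (J : R -> Prop), is_ideal J ->
        (forall x y, (x, y) \notin D -> F x y = 1%R) ->
        {in gs, forall g, balanced F J g.1 g.2} -> all_balanced e F J S].
Proof.
have [n] := ubnP #|S|; elim: n S => // n IHn S ltn.
have [->|S0] := eqVneq S set0.
  exists [::], set0; split; rewrite ?cards0 //.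
    by split=> [|z z']; rewrite ?inE.
  move=> R F J [J0 _ _] _ _ x [|y p] /=; first by rewrite /balanced subrr.
  by rewrite /restr /= !inE.
have [v vS good] := good_vertex e_sym e_irr free S0.
pose S' := S :\ v; have ES : v |: S' = S by rewrite setD1K.
have vS' : v \notin S' by rewrite !inE eqxx.
have [|gs [Z [gsP leq [ZS' Zsep] bal]]] := IHn S'.
  by move: ltn; rewrite (cardsD1 v S) vS.
have NS : nbrs e S v = nbrs e S' v by rewrite -ES nbrs_setU1.
have cS : #|S| = #|S'|.+1 by rewrite (cardsD1 v S) vS.
have leD : #|arcs_in S'| + #|nbrs e S' v| <= #|arcs_in S|.
  by rewrite -[in leqRHS]ES; apply: arcs_in_setU1.
have ZS : Z \subset S by apply: subset_trans ZS' _; apply: subsetDl.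
have sepS : nbrs e S' v != set0 -> {in nbrs e S' v &, forall a b, connect (restr e S') a b} ->
    {in Z &, forall z z', connect (restr e S) z z' -> z = z'}.
  move=> N0 conn z z' zZ z'Z; rewrite -ES => /(connect_setU1 vS' N0 conn) H.
  by apply: Zsep => //; apply: H; apply: (subsetP ZS').
have arc_e a b : (a, b) \in D -> e a b by rewrite (proj1 oD) => ->.
have F1 (R : comNzRingType) (F : V -> V -> R) :
    (forall x y, (x, y) \notin D -> F x y = 1%R) -> forall x y, F x y = 1%R \/ F y x = 1%R.
  move=> HF x y; case: (boolP ((x, y) \in D)) => [/(proj2 oD)|] /HF; by [right | left].
case: good => [simp|[a [b [Nv ab nab vab]]]].
  have simp' : simplicial e S' v by move: simp; rewrite /simplicial NS.
  pose leT (x y : V) := (x == y) || ((x, y) \in D).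
  (* Merge sort needs only totality for consecutive entries to be ordered, so it
     computes a Hamiltonian path of the tournament on the neighbours of v. *)
  pose s := sort leT (enum (nbrs e S' v)).
  have us : uniq s by rewrite sort_uniq enum_uniq.
  have ms : s =i nbrs e S' v by move=> z; rewrite mem_sort mem_enum.
  have ss : sorted (fun x y => (x, y) \in D) s.
    have: sorted leT s.
      apply: (@sort_sorted_in _ (mem (nbrs e S' v))).
        move=> x y xN yN; rewrite /leT (eq_sym y x); case: (eqVneq x y) => //= xy.
        by rewrite -(proj1 oD); apply: simp'.
      by apply/allP => z; rewrite mem_enum.
    elim: s us {ms} => // x [|y r] IHr //= /andP[xr ur] /andP[xy pr].
    have /= -> := IHr ur pr; rewrite andbT; move: xy; rewrite /leT; case: eqP => // xy.
    by move: xr; rewrite xy inE eqxx.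
  have szs : size s = #|nbrs e S' v| by rewrite size_sort -cardE.
  have zipP x y : (x, y) \in zip s (behead s) -> [/\ e v x, e x y & e y v].
    move=> /(zip_behead_sub ss)[]; rewrite !ms !inE => /andP[_ evx] /andP[_ evy] /arc_e.
    by rewrite (e_sym y).
  (* Consecutive pairs of [s] give one triangle less than [v] has neighbours, and none if there are
     no neighbours. *)
  exists ([seq (v, [:: xy.1; xy.2; v]) | xy <- zip s (behead s)] ++ gs).
  (* An isolated [v] adds a vertex but no arc; the count is restored by its new component,
     represented in [Z]. *)
  exists (if nbrs e S' v == set0 then v |: Z else Z); split.
  - move=> g; rewrite mem_cat => /orP[/mapP[[x y] /zipP[vx xy yv] ->]|/gsP //].
    by rewrite /= vx xy yv.
  - rewrite size_cat size_map size_zip size_behead szs; case: eqP => [N0|/eqP].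
      have vZ : v \notin Z by apply: contra vS' => /(subsetP ZS').
      move: leq leD; rewrite N0 cards0 cardsU1 vZ cS; clear; lia.
    move: leq leD; rewrite -card_gt0 cS; clear; lia.
  - case: (eqVneq (nbrs e S' v) set0) => [N0|N0].
      split; first by rewrite subUset sub1set vS.
      have iso x : restr e S v x = false.
        apply/negP => /and3P[_ xS evx]; have: x \in nbrs e S v by rewrite inE xS.
        by rewrite NS N0 inE.
      have notv z : connect (restr e S) v z -> v = z.
        by case/connectP => -[//|x p] /=; rewrite iso.
      have eqr : connect (restr e S) =2 connect (restr e S').
        apply: eq_connect => x y; apply/idP/idP => [xy|].
          move: (xy); rewrite /restr /= !inE => /and3P[-> -> ->]; rewrite !andbT.
          apply/andP; split; apply/eqP => E; first by move: xy; rewrite E iso.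
          by move: xy; rewrite E restr_sym // iso.
        by rewrite /restr /= !inE => /and3P[/andP[_ ->] /andP[_ ->] ->].
      move=> z z' /setU1P[->|zZ] /setU1P[->|z'Z] // c.
      - exact: notv.
      - by apply/esym/notv; rewrite restr_connect_sym.
      - by apply: Zsep; rewrite -?eqr.
    split=> //; apply: sepS => // a b aN bN; case: (eqVneq a b) => [->|ab].
      exact: connect0.
    apply: connect1; rewrite /restr /= simp' //.
    by move: aN bN; rewrite !inE => /andP[-> _] /andP[-> _].
  - move=> R F J idJ HF bg; have [J0 JD JM] := idJ; rewrite -ES.
    apply: (@simplicial_all_balanced _ _ e_sym e_irr _ _ _ (F1 _ _ HF) J0 JD JM
      (fun x y => (x, y) \in D) _ _ s) => //.
    + by move=> x y /(proj2 oD)/HF.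
    + move=> s1 x y s2 Es; apply: (bg (v, [:: x; y; v])); rewrite mem_cat.
      apply/orP; left; apply/mapP; exists (x, y) => //; rewrite Es; exact: mem_zip_behead.
    + by apply: bal HF _ => // g gg; apply: bg; rewrite mem_cat gg orbT.
have [q [pq uq cq sq]] := via_induced ab vab.
rewrite -/S' in sq.
have [aS bS eva evb] := nbrs_pair (etrans (esym NS) Nv).
(* At a corner, two new arcs against one new vertex leave room for exactly one generator, the
   hole. *)
exists ((v, a :: rcons (rcons q b) v) :: gs), Z; split.
- move=> g; rewrite inE => /predU1P[->|/gsP //] /=.
  by rewrite eva rcons_path pq !last_rcons e_sym evb.
- move: leq leD; rewrite -NS Nv cards2 ab cS /=; clear; lia.
- split=> //; apply: sepS.
    by rewrite -NS Nv; apply/set0Pn; exists a; rewrite !inE eqxx.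
  have cab : connect (restr e S') a b.
    apply/connectP; exists (rcons q b); last by rewrite last_rcons.
    move: pq sq; clear -aS bS; elim: q a aS => [|c q IHq] a aS /=.
      by rewrite /restr /= aS bS.
    move=> /andP[ac pq] sq; rewrite {1}/restr /= aS ac sq ?mem_head //=.
    by apply: IHq => // [|z zq]; apply: sq; rewrite inE ?eqxx ?zq ?orbT.
  move=> x y; rewrite -NS Nv => /set2P[] -> /set2P[] -> //; rewrite ?connect0 //.
  by rewrite restr_connect_sym.
- move=> R F J idJ HF bg; have [J0 JD JM] := idJ; rewrite -ES.
  apply: (@corner_all_balanced _ _ e_sym e_irr _ _ _ (F1 _ _ HF) J0 JD JM free v a b _ q) => //.
  + by rewrite -NS.
  + exact: (bg _ (mem_head _ _)).
  + by apply: bal HF _ => // g gg; apply: bg; rewrite inE gg orbT.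
Qed.

End Generators.

(** * The toric ideal *)

Section Toric.
Local Open Scope ring_scope.

Variables (k : fieldType) (V : finType) (D : {set V * V}).
Implicit Types (m : 'X_{1.. #|D|}) (p q : {mpoly k[#|D|]}).

(** The exponent vector of the image of ['X_[m]] under the toric map. With [m] read as a flow on the
    arcs, it is the net inflow at each vertex. *)
Definition boundary m : {ffun V -> int} :=
  [ffun z => \sum_(l < #|D|) arc_vector (enum_val l) z * (m l)%:Z].

Lemma boundaryD m m' : boundary (m + m')%MM = boundary m + boundary m'.
Proof.
apply/ffunP => z; rewrite [LHS]ffunE [RHS]ffunE [boundary m z]ffunE [boundary m' z]ffunE.
rewrite -big_split; apply: eq_bigr => l _ /=.
by rewrite mnmDE PoszD mulrDr.
Qed.

Lemma boundaryDE m m' z : boundary (m + m')%MM z = boundary m z + boundary m' z.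
Proof. by rewrite boundaryD ffunE. Qed.

(** Bounds the shift that clears the negative exponents in [toric_fiber_sum]. *)
Lemma boundary_bound m z : `|boundary m z| <= (mdeg m)%:Z.
Proof.
rewrite ffunE (le_trans (ler_norm_sum _ _ _)) // mdegE -natz natr_sum ler_sum // => l _.
rewrite normrM natz; have: `|arc_vector (enum_val l) z| <= 1.
  by rewrite /arc_vector; case: ifP => // _; case: ifP.
by rewrite (ger0_norm (_ : 0 <= (m l)%:Z)) // => H; rewrite -[leRHS]mul1r ler_wpM2r.
Qed.

Lemma vertex_var_neq0 (x : V) : vertex_var k x != 0.
Proof.
rewrite /vertex_var tofrac_eq0; apply/eqP => /(congr1 (mcoeff U_(enum_rank x))).
by rewrite mcoeffXU eqxx mcoeff0 => /eqP; rewrite oner_eq0.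
Qed.

Lemma toric_map_monomial m :
  mmap1 (fun l : 'I_#|D| => laurent_monomial k (arc_vector (enum_val l))) m
  = laurent_monomial k (boundary m).
Proof.
rewrite /mmap1 /laurent_monomial.
under [LHS]eq_bigr => l _ do rewrite -prodrXl.
rewrite exchange_big; apply: eq_bigr => x _ /=; rewrite ffunE.
rewrite (big_morph (fun i => vertex_var k x ^ i) (op1 := *%R) (id1 := 1)) //.
  by apply: eq_bigr => l _; rewrite -exprz_exp exprnP.
by move=> i j; rewrite expfzDr // vertex_var_neq0.
Qed.

Lemma toric_mapE p : toric_map p =
  \sum_(m <- msupp p) tofrac (p@_m)%:MP * laurent_monomial k (boundary m).
Proof. by apply: eq_bigr => m _; rewrite toric_map_monomial. Qed.

Lemma toric_map_is_ideal : [/\ @toric_ideal k V D 0,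
  forall p q, toric_ideal p -> toric_ideal q -> toric_ideal (p + q)
  & forall p q, toric_ideal q -> toric_ideal (p * q)].
Proof.
rewrite /toric_ideal /toric_map; split; first exact: rmorph0.
  by move=> p q; rewrite rmorphD /= => -> ->; rewrite addr0.
by move=> p q; rewrite rmorphM /= => ->; rewrite mulr0.
Qed.

Lemma toric_binomial m m' : boundary m = boundary m' ->
  @toric_ideal k V D ('X_[m] - 'X_[m']).
Proof.
move=> E; rewrite /toric_ideal /toric_map rmorphB /= !mmapX !toric_map_monomial E.
exact: subrr.
Qed.

(* Multiplying by a large monomial turns Laurent monomials into monomials. *)
Lemma toric_fiber_sum p (b : {ffun V -> int}) : toric_ideal p ->
  \sum_(m <- msupp p | boundary m == b) p@_m = 0.
Proof.
move=> p0; pose N := msize p.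
pose sh (c : {ffun V -> int}) : 'X_{1.. #|V|} :=
  [multinom absz (c (enum_val i) + N%:Z)%R | i < #|V|].
have pos m z : m \in msupp p -> 0 <= boundary m z + N%:Z.
  move=> mp; have := boundary_bound m z; have := msize_mdeg_lt mp; rewrite -/N.
  rewrite ler_norml => lt /andP[H _]; rewrite -lerBlDr sub0r (le_trans _ H) //.
  by rewrite lerN2 lez_nat ltnW.
have shE m : m \in msupp p ->
    tofrac ('X_[sh (boundary m)] : {mpoly k[#|V|]}) =
    laurent_monomial k (boundary m) * \prod_x vertex_var k x ^ N%:Z.
  move=> mp; rewrite mpolyXE_id rmorph_prod -big_split /=.
  rewrite (reindex (@enum_rank V)) /=; last exact: onW_bij (enum_rank_bij V).
  apply: eq_bigr => x _; rewrite rmorphXn /= mnmE enum_rankK exprnP -expfzDr ?vertex_var_neq0 //.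
  by rewrite gez0_abs // pos.
have: \sum_(m <- msupp p) p@_m *: ('X_[sh (boundary m)] : {mpoly k[#|V|]}) = 0.
  apply/eqP; rewrite -tofrac_eq0 rmorph_sum /=.
  rewrite (eq_big_seq (fun m => (tofrac (p@_m)%:MP * laurent_monomial k (boundary m))
     * \prod_x vertex_var k x ^ N%:Z)); last first.
    by move=> m mp; rewrite -mul_mpolyC rmorphM /= shE // mulrA.
  by rewrite -mulr_suml -toric_mapE p0 mul0r.
move=> H; have [/hasP[m0 m0p /eqP Eb]|no] := boolP (has (fun m => boundary m == b) (msupp p)).
  have := congr1 (mcoeff (sh b)) H; rewrite raddf_sum mcoeff0 /= => E.
  rewrite -[RHS]E big_mkcond; apply: eq_big_seq => m mp /=.
  rewrite mcoeffZ mcoeffX; case: eqP => [->|ne]; first by rewrite eqxx mulr1.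
  case: eqP => [Es|]; last by rewrite mulr0.
  case: ne; rewrite -Eb; apply/ffunP => z.
  have /(congr1 (fun s : 'X_{1.. #|V|} => s (enum_rank z))) := Es.
  rewrite -Eb !mnmE enum_rankK => /(congr1 Posz).
  by rewrite !gez0_abs ?pos // => /addIr.
by rewrite big_hasC.
Qed.

(** The coefficients of an element of the toric ideal sum to 0 over each fibre, so subtracting from
    each monomial a representative of its fibre changes nothing in total. *)
Lemma toric_ideal_sub (J : {mpoly k[#|D|]} -> Prop) :
  J 0 -> (forall p q, J p -> J q -> J (p + q)) -> (forall p q, J q -> J (p * q)) ->
  (forall m m', boundary m = boundary m' -> J ('X_[m] - 'X_[m'])) ->
  forall p, toric_ideal p -> J p.
Proof.
move=> J0 JD JM Jb p p0.
(* r m represents the fibre of m. *)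
pose r m := nth m (msupp p) (find (fun m' => boundary m' == boundary m) (msupp p)).
have rP m : m \in msupp p -> boundary (r m) = boundary m /\ r m \in msupp p.
  move=> mp; have h: has (fun m' => boundary m' == boundary m) (msupp p).
    by apply/hasP; exists m.
  by split; [apply/eqP; exact: (nth_find m h) | rewrite mem_nth // -has_find].
have rE m m' : m \in msupp p -> boundary m = boundary m' -> r m = r m'.
  move=> mp E; rewrite /r E; apply: set_nth_default.
  by rewrite -has_find; apply/hasP; exists m; rewrite // E.
have -> : p = \sum_(m <- msupp p) p@_m *: ('X_[m] - 'X_[r m]).
  under eq_bigr => m _ do rewrite scalerBr.
  rewrite sumrB -mpolyE; suff -> : \sum_(m <- msupp p) p@_m *: 'X_[r m] = 0 :> {mpoly k[#|D|]}.
    by rewrite subr0.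
  apply/mpolyP => m0; rewrite mcoeff0 raddf_sum /=.
  have [/hasP[m1 m1p /eqP Em1]|no] := boolP (has (fun m => r m == m0) (msupp p)).
    rewrite -[RHS](toric_fiber_sum (boundary m1) p0) [RHS]big_mkcond.
    apply: eq_big_seq => m mp; rewrite mcoeffZ mcoeffX -Em1.
    case: eqP => [E|ne]; last case: eqP => [E|]; rewrite ?mulr0 ?mulr1 //.
      by have [<- _] := rP m mp; have [<- _] := rP m1 m1p; rewrite E eqxx.
    by case: ne; apply: rE.
  rewrite big_seq big1 // => m mp; rewrite mcoeffZ mcoeffX.
  case: eqP => [E|]; rewrite ?mulr0 //; case/negP: no; apply/hasP; exists m => //; exact/eqP.
rewrite big_seq; apply: (big_ind J) => // m mp.
by rewrite -mul_mpolyC; apply: JM; apply: Jb; have [] := rP m mp.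
Qed.

End Toric.

(** * Binomials of closed walks *)

Lemma closed_subpath (T : finType) (g : rel T) x (p : seq T) :
  path g x p -> ~~ uniq (x :: p) ->
  exists y q, [/\ q != [::], path g y q, last y q = y & uniq q].
Proof.
elim: p x => [|y p IHp] x //; rewrite [path _ _ _]/= => /andP[gxy py].
case: (boolP (uniq (y :: p))) => [u|/(IHp _ py) //].
rewrite cons_uniq u andbT negbK => xp.
have [p1 [p2 Ep]] := mem_split xp; rewrite -cat_rcons in Ep.
have pxy : path g x (y :: p) by rewrite /= gxy.
exists x, (rcons p1 x); split.
- by case: (p1).
- by move: pxy; rewrite Ep cat_path => /andP[].
- by rewrite last_rcons.
- by move: u; rewrite Ep cat_uniq => /andP[].
Qed.

(** A walk that can always be continued eventually repeats a vertex, as [T] is finite. *)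
Lemma serial_cycle (T : finType) (g : rel T) u0 w0 : g u0 w0 ->
  (forall u w, g u w -> exists w', g w w') ->
  exists x p, [/\ p != [::], path g x p, last x p = x & uniq p].
Proof.
move=> g0 ser.
have long n : exists p, [/\ path g u0 p, size p = n.+1 & exists w', g (last u0 p) w'].
  elim: n => [|n [p [pp sp [w' gw']]]].
    by exists [:: w0]; split; rewrite /= ?g0 //; apply: ser g0.
  exists (rcons p w'); rewrite rcons_path pp gw' size_rcons sp last_rcons.
  by split=> //; apply: ser gw'.
have [p [pp sp _]] := long #|T|.
apply: (closed_subpath pp); apply/negP => /card_uniqP E.
by have := max_card [in u0 :: p]; rewrite E /= sp ltnNge leqnSn.
Qed.

Section WalkMonomials.
Local Open Scope ring_scope.

Variables (k : fieldType) (V : finType) (e : rel V) (D : {set V * V}).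
Hypotheses (e_sym : symmetric e) (e_irr : irreflexive e) (oD : orientation e D).
Implicit Types (x y z u w : V) (p : seq V) (m : 'X_{1.. #|D|}).

(** For a pair that is no arc this is the zero exponent, so of the two directions of an edge one
    gives the variable and the other gives 1. *)
Definition step_mnm x y : 'X_{1.. #|D|} :=
  [multinom ((enum_val l == (x, y)) : nat) | l < #|D|].

Fixpoint fw_mnm x p : 'X_{1.. #|D|} :=
  if p is y :: p' then (step_mnm x y + fw_mnm y p')%MM else 0%MM.
Fixpoint bw_mnm x p : 'X_{1.. #|D|} :=
  if p is y :: p' then (step_mnm y x + bw_mnm y p')%MM else 0%MM.

Definition step x y : {mpoly k[#|D|]} := 'X_[step_mnm x y].

Lemma fw_step x p : fw step x p = 'X_[fw_mnm x p].
Proof. by elim: p x => [|y p IHp] x /=; rewrite ?mpolyX0 // IHp mpolyXD. Qed.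

Lemma bw_step x p : bw step x p = 'X_[bw_mnm x p].
Proof. by elim: p x => [|y p IHp] x /=; rewrite ?mpolyX0 // IHp mpolyXD. Qed.

Lemma step_mnm0 x y : (x, y) \notin D -> step_mnm x y = 0%MM.
Proof.
move=> nD; apply/mnmP => l; rewrite mnmE mnm0E.
by case: eqP => // E; move: nD; rewrite -E enum_valP.
Qed.

Lemma step1 x y : (x, y) \notin D -> step x y = 1.
Proof. by move=> nD; rewrite /step step_mnm0 // mpolyX0. Qed.

Lemma no_loop x : (x, x) \notin D.
Proof. by apply/negP => Dxx; have /negP[] := proj2 oD _ _ Dxx. Qed.

Lemma boundary0 : boundary (0%MM : 'X_{1.. #|D|}) = 0.
Proof.
by apply/ffunP => z; rewrite !ffunE big1 // => l _; rewrite mnm0E mulr0.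
Qed.

Lemma boundary_step x y z : (x, y) \in D ->
  boundary (step_mnm x y) z = (z == y)%:Z - (z == x)%:Z.
Proof.
move=> Dxy; rewrite ffunE (bigD1 (enum_rank_in Dxy (x, y))) //= mnmE enum_rankK_in //.
rewrite eqxx mulr1 big1 ?addr0 => [|l nl].
  rewrite /arc_vector /=; case: eqP => [->|_]; last by case: eqP; rewrite subr0.
  by case: eqP => // E; move: Dxy; rewrite E (negbTE (no_loop _)).
rewrite mnmE; case: eqP => [E|_]; last by rewrite mulr0.
by case/eqP: nl; apply: enum_val_inj; rewrite enum_rankK_in.
Qed.

Lemma boundary_walk x p z : path e x p ->
  boundary (fw_mnm x p) z - boundary (bw_mnm x p) z
    = (z == last x p)%:Z - (z == x)%:Z.
Proof.
elim: p x => [|y p IHp] x /=; first by rewrite subrr subrr.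
rewrite (proj1 oD) => /andP[Dxy /IHp E].
rewrite !boundaryD ffunE [X in _ - X]ffunE.
suff H : boundary (step_mnm x y) z - boundary (step_mnm y x) z = (z == y)%:Z - (z == x)%:Z.
  rewrite opprD addrACA H E; ring.
case/orP: Dxy => Dxy; rewrite (boundary_step _ Dxy) step_mnm0 ?(proj2 oD) //.
  by rewrite boundary0 ffunE subr0.
by rewrite boundary0 ffunE sub0r opprB.
Qed.

Lemma boundary_closed x p : path e x p -> last x p = x ->
  boundary (fw_mnm x p) = boundary (bw_mnm x p).
Proof.
move=> pp lp; apply/ffunP => z; apply/eqP; rewrite -subr_eq0 boundary_walk //.
by rewrite lp subrr.
Qed.

Lemma fw_mnm_count x p l : (fw_mnm x p l <= count_mem (enum_val l).2 p)%N.
Proof.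
elim: p x => [|y p IHp] x /=; first by rewrite mnm0E.
rewrite mnmDE leq_add // mnmE; case: (enum_val l) => a b /=.
by rewrite xpair_eqE (eq_sym y); case: (_ == x).
Qed.

Lemma bw_mnm_count x p l : (bw_mnm x p l <= count_mem (enum_val l).1 p)%N.
Proof.
elim: p x => [|y p IHp] x /=; first by rewrite mnm0E.
rewrite mnmDE leq_add // mnmE; case: (enum_val l) => a b /=.
by rewrite xpair_eqE (eq_sym y); case: (_ == x); rewrite ?andbT ?andbF.
Qed.

Lemma fw_mnm_gt0 (g : rel V) x p l : path g x p -> (0 < fw_mnm x p l)%N ->
  g (enum_val l).1 (enum_val l).2.
Proof.
elim: p x => [|y p IHp] x /=; first by rewrite mnm0E.
move=> /andP[gxy pp]; rewrite mnmDE addn_gt0 => /orP[|/(IHp _ pp) //].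
by rewrite mnmE; case: eqP => // ->.
Qed.

Lemma bw_mnm_gt0 (g : rel V) x p l : path g x p -> (0 < bw_mnm x p l)%N ->
  g (enum_val l).2 (enum_val l).1.
Proof.
elim: p x => [|y p IHp] x /=; first by rewrite mnm0E.
move=> /andP[gxy pp]; rewrite mnmDE addn_gt0 => /orP[|/(IHp _ pp) //].
by rewrite mnmE; case: eqP => // ->.
Qed.

Lemma walk_mnm_neq0 x p : p != [::] -> path e x p ->
  (0 < mdeg (fw_mnm x p) + mdeg (bw_mnm x p))%N.
Proof.
case: p => //= y p _; rewrite (proj1 oD) => /andP[Dxy _]; rewrite !mdegD.
have main a b : (a, b) \in D -> (0 < mdeg (step_mnm a b))%N.
  move=> Dab; rewrite lt0n mdeg_eq0; apply/eqP => /mnmP/(_ (enum_rank_in Dab (a, b))).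
  by rewrite mnmE mnm0E enum_rankK_in // eqxx.
by case/orP: Dxy => /main; rewrite !addn_gt0 => ->; rewrite ?orbT.
Qed.

(* The steps of m along its arcs and of m' against its arcs; a cycle of this
   relation is a closed walk with forward part dividing m and backward part dividing m'. *)
Definition flow_rel m m' : rel V := [rel u w | [exists l : 'I_#|D|,
  ((0 < m l)%N && (enum_val l == (u, w))) || ((0 < m' l)%N && (enum_val l == (w, u)))]].

(** If no step leaves [w], all terms of the net inflow of [m - m'] at [w] are nonnegative; their sum
    is 0, so they vanish. Then [m] and [m'] agree on the arc between [u] and [w], and that arc also
    gives a step from [w] back to [u]. *)
Lemma flow_rel_serial m m' u w : boundary m = boundary m' ->
  flow_rel m m' u w -> exists w', flow_rel m m' w w'.
Proof.
move=> E guw; case: (pickP (flow_rel m m' w)) => [w' ?|no']; first by exists w'.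
have no u' : ~~ flow_rel m m' w u' by rewrite no'.
have t0 (l : 'I_#|D|) : 0 <= arc_vector (enum_val l) w * ((m l)%:Z - (m' l)%:Z).
  rewrite /arc_vector; case Ea : (enum_val l) => [a b] /=; case: eqP => [wa|_].
    have: m l == 0%N.
      rewrite -leqn0 leqNgt; apply/negP => ml; have /negP[] := no b; apply/existsP.
      by exists l; rewrite ml Ea wa eqxx.
    by move=> /eqP ->; rewrite sub0r mulrNN mul1r.
  case: eqP => [wb|_]; last by rewrite mul0r.
  have: m' l == 0%N.
    rewrite -leqn0 leqNgt; apply/negP => ml; have /negP[] := no a; apply/existsP.
    by exists l; rewrite ml Ea wb eqxx orbT.
  by move=> /eqP ->; rewrite subr0 mul1r.
have s0 : \sum_(l < #|D|) arc_vector (enum_val l) w * ((m l)%:Z - (m' l)%:Z) = 0.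
  move/ffunP/(_ w): E; rewrite !ffunE => /eqP; rewrite -subr_eq0 -sumrB => /eqP E.
  by rewrite -[RHS]E; apply: eq_bigr => l _; rewrite mulrBr.
have uw : w != u.
  apply/eqP => wu; subst w; case/existsP: guw => l /orP[] /andP[_ /eqP El];
    by have := enum_valP l; rewrite El (negbTE (no_loop _)).
have := psumr_eq0P (fun l _ => t0 l) s0 => z0.
have zero l : enum_val l = (u, w) \/ enum_val l = (w, u) -> m l = m' l.
  move=> El; have /eqP := z0 l isT; rewrite mulf_eq0 /arc_vector; case: El => -> /=.
    by rewrite (negbTE uw) eqxx oner_eq0 /= subr_eq0 => /eqP [].
  by rewrite eqxx oppr_eq0 oner_eq0 /= subr_eq0 => /eqP [].
case/existsP: guw => l /orP[] /andP[ml /eqP El].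
  have /negP[] := no u; apply/existsP; exists l.
  by rewrite -(zero l) ?ml ?El ?eqxx ?orbT //; left.
have /negP[] := no u; apply/existsP; exists l.
by rewrite (zero l) ?ml ?El ?eqxx ?orbT //; right.
Qed.

(** Induction on the total degree: remove a variable common to [m] and [m'], or, if there is none, a
    cycle of [flow_rel], whose binomial lies in [J]. *)
Lemma balanced_binomials (J : {mpoly k[#|D|]} -> Prop) :
  is_ideal J -> all_balanced e step J setT ->
  forall m m', boundary m = boundary m' -> J ('X_[m] - 'X_[m']).
Proof.
move=> [J0 JD JM] bal m m'; have [n] := ubnP (mdeg m + mdeg m')%N.
elim: n m m' => // n IHn m m' ltn E.
have peel c c' m1 m1' : m = (c + m1)%MM -> m' = (c' + m1')%MM ->
    boundary c = boundary c' -> (0 < mdeg c + mdeg c')%N -> J ('X_[c] - 'X_[c']) ->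
    J ('X_[m] - 'X_[m']).
  move=> Em Em' Ec lt0 Jc; rewrite Em Em' !mpolyXD.
  have -> : 'X_[c] * 'X_[m1] - 'X_[c'] * 'X_[m1'] = 'X_[m1] * ('X_[c] - 'X_[c'])
      + 'X_[c'] * ('X_[m1] - 'X_[m1']) :> {mpoly k[#|D|]} by ring.
  apply: JD; apply: JM => //; apply: IHn.
    by move: ltn lt0; rewrite Em Em' !mdegD; clear; lia.
  by move: E; rewrite Em Em' !boundaryD Ec => /addrI.
case: (pickP (fun l => (0 < m l)%N && (0 < m' l)%N)) => [l /andP[ml ml']|dis].
  apply: (peel U_(l)%MM U_(l)%MM (m - U_(l))%MM (m' - U_(l))%MM); rewrite ?mdeg1 ?subrr //.
  - by rewrite addmC submK // lep1mP -lt0n.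
  - by rewrite addmC submK // lep1mP -lt0n.
have g0 : (forall u w, ~~ flow_rel m m' u w) -> m = m'.
  move=> no; apply/mnmP => l; case Ea : (enum_val l) => [a b].
  have := no a b; rewrite negb_exists => /forallP/(_ l).
  have := no b a; rewrite negb_exists => /forallP/(_ l).
  by rewrite Ea !eqxx !andbT !negb_or -!eqn0Ngt => /andP[_ /eqP ->] /andP[/eqP -> _].
case: (pickP (fun uw => flow_rel m m' uw.1 uw.2)) => [[u w] /= guw|no]; last first.
  by rewrite g0 ?subrr // => u w; rewrite (no (u, w)).
have [x [p [p0 pp lp up]]] := serial_cycle guw (fun u w => @flow_rel_serial m m' u w E).
have ge u1 w1 : flow_rel m m' u1 w1 -> e u1 w1.
  case/existsP => l /orP[] /andP[_ /eqP El]; rewrite (proj1 oD);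
    by have := enum_valP l; rewrite El => ->; rewrite ?orbT.
have pe : path e x p by apply: sub_path pp.
(* The cycle repeats no vertex, so it uses every arc at most once and its exponents are at most
   1. *)
have lef : (fw_mnm x p <= m)%MM.
  apply/mnm_lepP => l; have le1 := leq_trans (fw_mnm_count x p l) (uniq_count _ up).
  case: (posnP (fw_mnm x p l)) => [->|gt0] //; apply: leq_trans le1 _.
  have /existsP[l' /orP[]] := fw_mnm_gt0 pp gt0; rewrite -?surjective_pairing => /andP[ml' /eqP E'].
    by rewrite -(enum_val_inj E').
  have := enum_valP l; rewrite [enum_val l]surjective_pairing => /(proj2 oD).
  by have := enum_valP l'; rewrite E' => ->.
have leb : (bw_mnm x p <= m')%MM.
  apply/mnm_lepP => l; have le1 := leq_trans (bw_mnm_count x p l) (uniq_count _ up).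
  case: (posnP (bw_mnm x p l)) => [->|gt0] //; apply: leq_trans le1 _.
  have /existsP[l' /orP[]] := bw_mnm_gt0 pp gt0; rewrite -?surjective_pairing => /andP[ml' /eqP E'].
    have := enum_valP l'; rewrite E' => /(proj2 oD); by rewrite -surjective_pairing enum_valP.
  by rewrite -(enum_val_inj E').
apply: (peel (fw_mnm x p) (bw_mnm x p) (m - fw_mnm x p)%MM (m' - bw_mnm x p)%MM).
- by rewrite addmC submK.
- by rewrite addmC submK.
- exact: boundary_closed.
- exact: walk_mnm_neq0.
- rewrite -fw_step -bw_step; apply: bal => //.
  by apply: sub_path pe => a b; rewrite /restr /= !inE.
Qed.

End WalkMonomials.

Lemma card_separated_n_comp (V : finType) (e : rel V) (Z : {set V}) :
  symmetric e -> {in Z &, forall z z', connect e z z' -> z = z'} ->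
  (#|Z| <= n_comp e predT)%N.
Proof.
move=> e_sym sep; have cs : connect_sym e := sym_connect_sym e_sym.
rewrite -(card_in_imset (f := fingraph.root e)); last first.
  by move=> z z' zZ z'Z /eqP; rewrite (root_connect cs); apply: sep.
apply/subset_leq_card/subsetP => _ /imsetP[z _ ->].
by rewrite !inE roots_root.
Qed.

(** * From generating closed walks to complete intersections *)

Section Sufficiency.
Local Open Scope ring_scope.

Lemma ear_free_CIO (k : fieldType) (V : finType) (e : rel V) :
  symmetric e -> irreflexive e -> ear_free e -> CIO k e.
Proof.
move=> e_sym e_irr free D oD.
have [gs [Z [gsP leq [_ sep] bal]]] := closed_walk_generators e_sym e_irr oD free setT.
have arcsT : arcs_in D setT = D by apply/setP => a; rewrite !inE !andbT.
have leZ : (#|Z| <= n_comp e predT)%N.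
  apply: card_separated_n_comp => // z z' zZ z'Z c; apply: sep => //.
  by rewrite (eq_connect (e' := e)) // => a b; rewrite /restr /= !inE.
rewrite arcsT cardsT in leq.
pose bs : seq {mpoly k[#|D|]} :=
  [seq 'X_[fw_mnm D g.1 g.2] - 'X_[bw_mnm D g.1 g.2] | g <- gs].
have szb : (size bs <= #|D| + n_comp e predT - #|V|)%N.
  by rewrite size_map; move: leq leZ; clear; lia.
have bin b : b \in bs -> is_binomial b /\ toric_ideal b.
  case/mapP => g /gsP[pg lg] ->; split; first by do 2!eexists.
  exact/toric_binomial/(boundary_closed oD).
(* The list may be shorter than the height; it is padded with 0, the difference of two equal
   monomials. *)
exists (fun i => nth 0 bs i); split.
  move=> i; case: (ltnP i (size bs)) => [lt|ge]; first by have [] := bin _ (mem_nth 0 lt).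
  by rewrite nth_default //; exists 0%MM, 0%MM; rewrite subrr.
have [T0 TD TM] := @toric_map_is_ideal k V D.
move=> p; split=> [|[c ->]]; last first.
  apply: (big_ind (@toric_ideal k V D)) => // i _; apply: TM.
  case: (ltnP i (size bs)) => [lt|ge]; first by have [] := bin _ (mem_nth 0 lt).
  by rewrite nth_default.
pose h := (#|D| + n_comp e predT - #|V|)%N.
pose J (p : {mpoly k[#|D|]}) := exists c, p = \sum_(i < h) c i * nth 0 bs i.
have idJ : is_ideal J.
  split.
  - by exists (fun=> 0); rewrite big1 // => i _; rewrite mul0r.
  - move=> _ _ [c ->] [d ->]; exists (fun i => c i + d i).
    by rewrite -big_split; apply: eq_bigr => i _; rewrite mulrDl.
  - move=> r _ [c ->]; exists (fun i => r * c i).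
    by rewrite mulr_sumr; apply: eq_bigr => i _; rewrite mulrA.
have [J0 JD JM] := idJ.
apply: (toric_ideal_sub J0 JD JM).
apply: (balanced_binomials oD idJ); apply: (bal _ _ _ idJ).
  by move=> x y; apply: step1.
move=> g gg; rewrite /balanced fw_step bw_step.
set b := 'X_[_] - _; have bg : b \in bs by apply/mapP; exists g.
have lt : (index b bs < h)%N by apply: leq_trans szb; rewrite index_mem.
exists (fun i => (i == Ordinal lt)%:R).
rewrite (bigD1 (Ordinal lt)) //= eqxx mul1r nth_index // big1 ?addr0 // => i /negbTE ->.
by rewrite mul0r.
Qed.

End Sufficiency.

(** * Dependent generators *)

Section CoefficientSums.
Local Open Scope ring_scope.

Variables (k : fieldType) (n : nat) (P : pred 'X_{1..n}).
Implicit Types (p q : {mpoly k[n]}) (m : 'X_{1..n}).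

Definition coef_sum p : k := \sum_(m <- msupp p | P m) p@_m.

(** A sum over an index set not depending on the support makes additivity visible. *)
Lemma coef_sum_bounded p d : (msize p <= d)%N ->
  coef_sum p = \sum_(m : 'X_{1..n < d} | P m) p@_m.
Proof.
move=> le_pd; rewrite /coef_sum big_mkcond [RHS]big_mkcond /=.
set I : subFinType _ := 'X_{1..n < d}.
rewrite (big_mksub I) ?msupp_uniq //=; last first.
  by move=> x /msize_mdeg_lt /leq_trans; apply.
rewrite big_rmcond //= => j /memN_msupp_eq0 ->.
by case: ifP.
Qed.

Lemma coef_sumD p q : coef_sum (p + q) = coef_sum p + coef_sum q.
Proof.
pose d := maxn (msize (p + q)) (maxn (msize p) (msize q)).
rewrite !(@coef_sum_bounded _ d) ?leq_max ?leqnn ?orbT // -big_split.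
by apply: eq_bigr => m _; rewrite mcoeffD.
Qed.

Lemma coef_sum_monomial c m : coef_sum (c *: 'X_[m]) = c * (P m)%:R.
Proof.
have [->|c0] := eqVneq c 0.
  by rewrite scale0r mul0r /coef_sum msupp0 big_nil.
rewrite /coef_sum msuppMCX // big_cons big_nil mcoeffZ mcoeffX eqxx mulr1.
by case: (P m); rewrite ?mulr1 ?mulr0 ?addr0.
Qed.

Lemma coef_sum0 : coef_sum 0 = 0.
Proof. by rewrite /coef_sum msupp0 big_nil. Qed.

Lemma coef_sum_big (I : Type) (r : seq I) (Q : pred I) (F : I -> {mpoly k[n]}) :
  coef_sum (\sum_(i <- r | Q i) F i) = \sum_(i <- r | Q i) coef_sum (F i).
Proof. exact: (big_morph coef_sum coef_sumD coef_sum0). Qed.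

Lemma coef_sum_binomial m m' : coef_sum ('X_[m] - 'X_[m']) = (P m)%:R - (P m')%:R.
Proof.
rewrite -scaleN1r -['X_[m]]scale1r coef_sumD !coef_sum_monomial.
by rewrite mul1r mulN1r.
Qed.

Lemma bool_natr_inj (a b : bool) : a%:R - b%:R = 0 :> k -> a = b.
Proof.
case: a b => -[] //= /eqP; rewrite ?subr0 ?sub0r ?oppr_eq0 oner_eq0 //.
Qed.

(** The functional [coef_sum] vanishes on every multiple of a generator when [P] does not
    distinguish its two terms, hence on the given binomial. Since 1 differs from 0 in [k], this
    forces [P a = P b] in every characteristic. *)
Lemma invariant_binomial h (al be : 'I_h -> 'X_{1..n}) (c : 'I_h -> {mpoly k[n]}) a b :
  'X_[a] - 'X_[b] = \sum_(i < h) c i * ('X_[al i] - 'X_[be i]) ->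
  (forall i m, P (m + al i)%MM = P (m + be i)%MM) -> P a = P b.
Proof.
move=> E inv; apply: bool_natr_inj; rewrite -coef_sum_binomial E coef_sum_big.
rewrite big1 // => i _; rewrite [c i]mpolyE mulr_suml coef_sum_big big1 // => m _.
rewrite -scalerAl mulrBr -!mpolyXD scalerBr -scaleNr coef_sumD !coef_sum_monomial.
by rewrite inv mulNr subrr.
Qed.

End CoefficientSums.

Section Rank.
Local Open Scope ring_scope.

Variables (V : finType) (e : rel V) (D : {set V * V}).
Hypotheses (e_sym : symmetric e) (oD : orientation e D).

Definition incidence : 'M[rat]_(#|D|, #|V|) :=
  \matrix_(l, x) (arc_vector (enum_val l) (enum_val x))%:~R.

Lemma arc_vector_sum (R : comNzRingType) (g : V -> R) (a : V * V) : a.1 != a.2 ->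
  \sum_z (arc_vector a z)%:~R * g z = g a.2 - g a.1.
Proof.
move=> ne; rewrite (bigD1 a.1) //= (bigD1 a.2) 1?eq_sym //= /arc_vector eqxx.
rewrite eq_sym (negbTE ne) eqxx big1 => [|z /andP[z1 z2]].
  by rewrite mulN1r mul1r addr0 addrC.
by rewrite (negbTE z1) (negbTE z2) mul0r.
Qed.

Lemma common_denominator q (w : 'I_q -> rat) :
  exists (N : rat) (z : 'I_q -> int), N != 0 /\ forall l, w l * N = (z l)%:~R.
Proof.
pose N := \prod_l denq (w l); exists N%:~R.
exists (fun l => numq (w l) * \prod_(l' | l' != l) denq (w l')); split.
  by rewrite intr_eq0; apply/prodf_neq0 => l _; apply: denq_neq0.
move=> l; rewrite /N (bigD1 l) //= !intrM mulrA; congr (_ * _).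
by rewrite -{1}[w l]divq_num_den mulfVK // intr_eq0 denq_neq0.
Qed.

(** The indicator functions of the components, the columns of [K], are annihilated by the incidence
    matrix. They are independent because evaluation at the component roots gives the identity
    matrix. *)
Lemma rank_incidence : (\rank incidence + n_comp e predT <= #|V|)%N.
Proof.
have cs : connect_sym e := sym_connect_sym e_sym.
pose RS := [set x | roots e x].
have -> : n_comp e predT = #|RS| by apply: eq_card => x; rewrite !inE andbT.
pose K : 'M[rat]_(#|V|, #|RS|) :=
  \matrix_(x, c) (fingraph.root e (enum_val x) == enum_val c)%:R.
pose L : 'M[rat]_(#|RS|, #|V|) := \matrix_(c, x) (enum_val x == enum_val c)%:R.
have rK : \rank K = #|RS|.
  apply/eqP; rewrite eqn_leq rank_leq_col -{1}(mxrank1 rat #|RS|).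
  suff <- : L *m K = 1%:M by apply: mxrankM_maxr.
  apply/matrixP => c c'; rewrite !mxE (bigD1 (enum_rank (enum_val c))) //= !mxE enum_rankK.
  have /[!inE]/eqP -> := enum_valP c; rewrite eqxx mul1r (inj_eq enum_val_inj).
  rewrite big1 ?addr0 // => x nx; rewrite !mxE; case: eqP => [E|]; last by rewrite mul0r.
  by move: nx; rewrite -E enum_valK eqxx.
rewrite -rK; apply: mulmx0_rank_max; apply/matrixP => l c; rewrite !mxE.
pose g z : rat := (fingraph.root e z == enum_val c)%:R.
rewrite (eq_bigr (fun x => (arc_vector (enum_val l) (enum_val x))%:~R
  * g (enum_val x))); last first.
  by move=> x _; rewrite !mxE.
rewrite -(big_enum_val (fun z => (arc_vector (enum_val l) z)%:~R * g z)) /=.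
have Dl := enum_valP l; rewrite [enum_val l]surjective_pairing in Dl.
rewrite arc_vector_sum; last first.
  by apply/eqP => E; have /negP[] := proj2 oD _ _ Dl; move: Dl; rewrite E.
rewrite /g; have: fingraph.root e (enum_val l).1 == fingraph.root e (enum_val l).2.
  by rewrite (root_connect cs) connect1 // (proj1 oD) Dl.
by move/eqP ->; rewrite subrr.
Qed.

End Rank.

Section NotCompleteIntersection.
Local Open Scope ring_scope.

Variables (k : fieldType) (V : finType) (e : rel V) (D : {set V * V}).
Hypotheses (e_sym : symmetric e) (oD : orientation e D).
Implicit Types (m c d : 'X_{1.. #|D|}).

Lemma toric_binomial_boundary m m' : @toric_ideal k V D ('X_[m] - 'X_[m']) ->
  boundary m = boundary m'.
Proof.
move=> T; apply/esym/eqP; have := toric_fiber_sum (boundary m) T.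
rewrite -[LHS]/(coef_sum (fun m1 => boundary m1 == boundary m) _) coef_sum_binomial.
by move/bool_natr_inj <-; rewrite eqxx.
Qed.

Definition weight (u : 'rV[rat]_#|D|) m : rat := \sum_l u 0 l * (m l)%:R.

Lemma weightD u m m' : weight u (m + m')%MM = weight u m + weight u m'.
Proof.
rewrite /weight -big_split; apply: eq_bigr => l _ /=.
by rewrite mnmDE natrD mulrDr.
Qed.

(* The rows of N will be the exponent differences of all generators but one. *)
Lemma exists_weight h (N : 'M[rat]_(h, #|D|)) :
  (h + #|V| < #|D| + n_comp e predT)%N ->
  exists u : 'rV[rat]_#|D|, u *m N^T = 0 /\
    exists m m', boundary m = boundary m' /\ weight u m != weight u m'.
Proof.
move=> lt; have rA := rank_incidence e_sym oD.
(* The kernel has rank at least [#|D| - h], while the row space of the transposed incidence matrix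
   has rank at most [#|V| - n_comp e predT], which is smaller. *)
have nle : ~~ (kermx N^T <= (incidence D)^T)%MS.
  apply/negP => /mxrankS; rewrite mxrank_ker !mxrank_tr.
  have := rank_leq_row N; have := rank_leq_row (incidence D).
  by move: lt rA; move: (\rank N) (\rank _) => rN rI; clear; lia.
have [t nt] : exists t, ~~ (row t (kermx N^T) <= (incidence D)^T)%MS.
  apply/existsP; rewrite -[X in is_true X]negbK negb_exists; apply: contra nle.
  by move/forallP => all_le; apply/row_subP => t; have := all_le t; rewrite negbK.
exists (row t (kermx N^T)); split.
  by rewrite -row_mul mulmx_ker row0.
move: nt; set u := row t _; rewrite submxE => nt.
have [j uj] : exists j, (u *m cokermx (incidence D)^T) 0 j != 0.
  apply/existsP; rewrite -[X in is_true X]negbK negb_exists; apply: contra nt.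
  move/forallP => all0; apply/eqP/rowP => j; rewrite [RHS]mxE; apply/eqP.
  by have := all0 j; rewrite negbK.
(* Column [j] of the cokernel is a rational cycle on which [u] does not vanish. Clearing
   denominators and splitting by sign yields [m] and [m']. *)
pose w l := cokermx (incidence D)^T l j.
have [N0 [z [N0n0 zE]]] := common_denominator w.
pose m : 'X_{1.. #|D|} := [multinom (if (0 <= z l)%R then absz (z l) else 0) | l < #|D|].
pose m' : 'X_{1.. #|D|} := [multinom (if (0 <= z l)%R then 0 else absz (z l)) | l < #|D|].
have mz l : (m l)%:Z - (m' l)%:Z = z l.
  rewrite !mnmE; case: (lerP 0 (z l)) => h0; first by rewrite subr0 gez0_abs.
  by rewrite sub0r ltz0_abs // opprK.
exists m, m'; split.
  apply/ffunP => x; apply/eqP; rewrite -subr_eq0 !ffunE -sumrB.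
  apply/eqP; apply: (@intr_inj rat); rewrite rmorph_sum /=.
  have /matrixP/(_ (enum_rank x) j) := mulmx_coker (incidence D)^T.
  rewrite mxE [RHS]mxE => E; rewrite -[RHS](mul0r N0) -[X in _ = X * _]E mulr_suml.
  apply: eq_bigr => l _; rewrite [_^T _ _]mxE [incidence _ _ _]mxE enum_rankK.
  by rewrite -mulrBr mz intrM -zE mulrA.
apply/eqP => E; move: uj; rewrite mxE => /eqP[]; apply: (mulIf N0n0); rewrite mul0r.
move/eqP: E; rewrite -subr_eq0 -sumrB => /eqP E; rewrite -[RHS]E mulr_suml.
apply: eq_bigr => l _; rewrite -mulrBr -mulrA -/(w l) zE -mz intrD intrN.
by [].
Qed.

(* cp and cm are the monomials of the hole; a1, b1 and a2, b2 are the monomials whose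
   exponent differences differ by cp - cm but whose fibres avoid cp and cm. *)
Lemma not_binomial_complete_intersection cp cm a1 b1 a2 b2 :
  boundary cp = boundary cm -> cp != cm ->
  (forall l, cp l = 0%N \/ cm l = 0%N) ->
  (forall m, boundary m = boundary cp -> m = cp \/ m = cm) ->
  boundary a1 = boundary b1 -> boundary a2 = boundary b2 ->
  (a1 + b2 + cm = b1 + a2 + cp)%MM ->
  (forall a m c, (a == a1) || (a == a2) -> (c == cp) || (c == cm) ->
     boundary (m + c)%MM != boundary a) ->
  ~ binomial_complete_intersection k e D.
Proof.
move=> Ec ncp disj fib E1 E2 Edep nodiv [f [bin gen]].
have [al] := fin_all_exists bin; move=> /fin_all_exists[be fE].
have fT i : toric_ideal (f i).
  apply/gen; exists (fun j => (j == i)%:R); rewrite (bigD1 i) //= eqxx mul1r.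
  by rewrite big1 ?addr0 // => j /negbTE ->; rewrite mul0r.
have bE i : boundary (al i) = boundary (be i).
  by apply: toric_binomial_boundary; rewrite -fE.
have inv (P : pred 'X_{1.. #|D|}) a b : boundary a = boundary b ->
    (forall i m, P (m + al i)%MM = P (m + be i)%MM) -> P a = P b.
  move=> Eab HP; have /gen[c] := toric_binomial k Eab.
  under eq_bigr => i _ do rewrite fE.
  by move=> E; apply: (invariant_binomial E HP).
(* Otherwise [cp] could not be moved: a move from it leads within its fibre to [cm], and as the two
   are coprime, the multiplier is 1 and the generator itself is the hole binomial up to sign. *)
have [i Hi] : exists i, ((al i == cp) && (be i == cm)) || ((al i == cm) && (be i == cp)).
  case: (pickP (fun i => ((al i == cp) && (be i == cm)) || ((al i == cm) && (be i == cp)))).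
    by move=> i Hi; exists i.
  move=> no.
  have gcd0 m d d' : (m + d)%MM = cp -> (m + d')%MM = cm -> d = cp /\ d' = cm.
    move=> Ed Ed'; suff m0 : m = 0%MM by rewrite -Ed -Ed' m0 !add0m.
    apply/mnmP => l; rewrite mnm0E; apply/eqP.
    by case: (disj l); rewrite -?Ed -?Ed' mnmDE => /eqP; rewrite addn_eq0 => /andP[].
  have := inv (pred1 cp) cp cm Ec; rewrite /= eqxx => H.
  suff /esym/eqP E : true = (cm == cp) by move: ncp; rewrite E eqxx.
  apply: H => i m; have := negbT (no i); rewrite negb_or => /andP[no1 no2].
  have bE' : boundary (m + al i)%MM = boundary (m + be i)%MM by rewrite !boundaryD bE.
  apply/eqP/eqP => E.
    have := fib (m + be i)%MM; rewrite -bE' E => /(_ erefl)[] // E'.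
    by have [Ea Eb] := gcd0 _ _ _ E E'; move: no1; rewrite Ea Eb !eqxx.
  have := fib (m + al i)%MM; rewrite bE' E => /(_ erefl)[] // E'.
  by have [Eb Ea] := gcd0 _ _ _ E E'; move: no2; rewrite Ea Eb !eqxx.
pose M : 'M[rat]_(_, #|D|) := \matrix_(j, l) ((al j l)%:R - (be j l)%:R).
have hpos : (0 < #|D| + n_comp e predT - #|V|)%N by apply: leq_ltn_trans (ltn_ord i).
(* With generator [i] left out, the remaining rows are too few to span the cycle space. *)
have [|u [uN [m [m' [Em]]]]] := exists_weight (row' i M).
  by move: hpos; move: (#|D| + _)%N #|V| => a b; clear; case: (leqP a b); lia.
case/eqP; have uj j : j != i -> weight u (al j) = weight u (be j).
  rewrite eq_sym => ji; have [j' Ej _] := unlift_some ji.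
  move/rowP/(_ j'): uN; rewrite !mxE => E; apply/eqP.
  rewrite -subr_eq0 -sumrB -[X in _ == X]E; apply/eqP/eq_bigr => l _.
  by rewrite !mxE -Ej mulrBr.
(* By [nodiv] the generator [i] never acts in the fibres of [a1] and [a2], and [u] vanishes on all
   the others. *)
have eqw a b : (a == a1) || (a == a2) -> boundary a = boundary b -> weight u a = weight u b.
  move=> Ha Eab; apply/esym/eqP.
  pose P m0 := (boundary m0 == boundary a) && (weight u m0 == weight u a).
  suff : P a = P b by rewrite /P Eab !eqxx /= => <-.
  apply: inv => // j m0; rewrite /P.
  case: (eqVneq j i) => [->|ji]; last by rewrite !boundaryD bE !weightD uj.
  have [ci di] : ((al i == cp) || (al i == cm)) /\ ((be i == cp) || (be i == cm)).
    by case/orP: Hi => /andP[-> ->]; rewrite ?orbT.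
  by rewrite !(negbTE (nodiv _ _ _ Ha _)).
have wc : weight u cp = weight u cm.
  have := congr1 (weight u) Edep; rewrite !weightD.
  rewrite (eqw _ _ _ E1) ?eqxx // (eqw _ _ _ E2) ?eqxx ?orbT //.
  by move/addrI.
(* By the dependence [u] vanishes on generator [i] too, so the weight is constant on every fibre,
   against the choice of [m] and [m']. *)
apply/eqP; have wall j : weight u (al j) = weight u (be j).
  case: (eqVneq j i) => [->|/uj //].
  by case/orP: Hi => /andP[/eqP -> /eqP ->].
pose P m0 := weight u m0 == weight u m.
suff E : P m = P m' by move: E; rewrite /P eqxx => /esym/eqP ->.
by apply: inv => // j m0; rewrite /P !weightD wall.
Qed.

End NotCompleteIntersection.

(** * The orientation of an eared hole *)

Section RankedOrientation.
Local Open Scope ring_scope.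

Variables (V : finType) (e : rel V) (s0 : seq V).
Hypotheses (e_sym : symmetric e) (e_irr : irreflexive e) (us0 : uniq s0).
Implicit Types (u z : V).

(** A linear order of all vertices with [s0] as initial segment. *)
Definition rank z := index z (s0 ++ enum V).

Definition ranked_arcs : {set V * V} := [set a | e a.1 a.2 && (rank a.1 < rank a.2)%N].

Local Notation D := ranked_arcs.
Implicit Types (m : 'X_{1.. #|D|}).

Lemma mem_ranked_arcs u z : ((u, z) \in D) = e u z && (rank u < rank z)%N.
Proof. by rewrite inE. Qed.

Lemma rank_inj : injective rank.
Proof.
move=> u z E; have all_mem v : v \in s0 ++ enum V by rewrite mem_cat mem_enum orbT.
by rewrite -(nth_index u (all_mem u)) -[index u _]/(rank u) E nth_index.
Qed.

Lemma ranked_orientation : orientation e D.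
Proof.
split=> u z; rewrite !mem_ranked_arcs; last first.
  by case/andP=> _ lt; rewrite (ltnNge (rank z)) (ltnW lt) andbF.
rewrite (e_sym z) -andb_orr -neq_ltn; case: (boolP (e u z)) => //= euz.
apply/esym; apply: contraTneq euz => /rank_inj ->; by rewrite e_irr.
Qed.

Lemma rank_mem z : (rank z < size s0)%N = (z \in s0).
Proof.
rewrite /rank index_cat; case: ifP => zs; first by rewrite index_mem.
by rewrite ltnNge leq_addr.
Qed.

Lemma sorted_rank : sorted (fun u z => rank u < rank z)%N s0.
Proof.
have rankE z : z \in s0 -> rank z = index z s0 by move=> zs; rewrite /rank index_cat zs.
case E : s0 => [|c s] //; rewrite -E; apply/(sortedP c) => i lt.
by rewrite !rankE ?mem_nth ?index_uniq // ltnW.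
Qed.

Lemma sorted_subseq_rank s : subseq s s0 -> sorted (fun u z => rank u < rank z)%N s.
Proof.
move=> sub; apply: (subseq_sorted _ sub sorted_rank).
by move=> c b a; apply: ltn_trans.
Qed.

Lemma rank_lt s1 u s2 z s3 : s0 = s1 ++ u :: s2 ++ z :: s3 -> (rank u < rank z)%N.
Proof.
move=> E; have: sorted (fun u z => rank u < rank z)%N [:: u; z].
  apply: sorted_subseq_rank; rewrite E; apply: subseq_trans (suffix_subseq s1 _).
  by rewrite /= eqxx sub1seq mem_cat mem_head orbT.
by rewrite /= andbT.
Qed.

Lemma ranked_path u p : path e u p -> subseq (u :: p) s0 ->
  path (fun u z => (u, z) \in D) u p.
Proof.
move=> pe /sorted_subseq_rank /=; elim: p u pe => //= z p IHp u /andP[euz pz] /andP[lt pl].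
by rewrite mem_ranked_arcs euz lt IHp.
Qed.

(** The net inflow into the vertices of rank at least [t] is the flow across the cut. All arcs point
    upwards, so it is nonnegative, and positive as soon as some arc carrying flow crosses. *)
Lemma cut_sum m t :
  \sum_(z | (t <= rank z)%N) boundary m z =
  \sum_l (m l)%:Z * ((t <= rank (enum_val l).2)%N%:Z - (t <= rank (enum_val l).1)%N%:Z).
Proof.
rewrite (eq_bigr (fun z => \sum_l arc_vector (enum_val l) z * (m l)%:Z)); last first.
  by move=> z _; rewrite ffunE.
rewrite exchange_big; apply: eq_bigr => l _ /=; rewrite -mulr_suml mulrC; congr (_ * _).
rewrite -!natz -(arc_vector_sum (R := int) (fun z => (t <= rank z)%N%:R)).
  rewrite big_mkcond; apply: eq_bigr => z _; rewrite intz.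
  by case: ifP; rewrite ?mulr1 ?mulr0.
have := enum_valP l; rewrite [enum_val l]surjective_pairing mem_ranked_arcs /= => /andP[+ _].
by apply: contraTneq => ->; rewrite e_irr.
Qed.

Lemma cut_term m t (l : 'I_#|D|) :
  0 <= (m l)%:Z * ((t <= rank (enum_val l).2)%N%:Z - (t <= rank (enum_val l).1)%N%:Z).
Proof.
apply: mulr_ge0 => //; rewrite subr_ge0.
have := enum_valP l; rewrite [enum_val l]surjective_pairing mem_ranked_arcs /= => /andP[_ lt].
by case: (leqP t (rank (enum_val l).1)) => // /leq_trans/(_ (ltnW lt)) ->.
Qed.

Lemma cut_ge0 m t : 0 <= \sum_(z | (t <= rank z)%N) boundary m z.
Proof. by rewrite cut_sum sumr_ge0 // => l _; apply: cut_term. Qed.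

Lemma cut_crossing m t (l : 'I_#|D|) : (0 < m l)%N ->
  (rank (enum_val l).1 < t <= rank (enum_val l).2)%N ->
  0 < \sum_(z | (t <= rank z)%N) boundary m z.
Proof.
move=> ml /andP[lt1 lt2]; rewrite cut_sum (bigD1 l) //= lt2 leqNgt lt1 /= mulr1.
by apply: ltr_wpDr; [apply: sumr_ge0 => i _; apply: cut_term | rewrite ltz_nat].
Qed.

(** The orientation is acyclic: an arc carrying flow crosses the cut just below its head. *)
Lemma boundary0_eq0 m : boundary m = 0 -> m = 0%MM.
Proof.
move=> E; apply/mnmP => l; rewrite mnm0E; case: (posnP (m l)) => // ml.
have := @cut_crossing m (rank (enum_val l).2) l ml; rewrite leqnn andbT.
have := enum_valP l; rewrite [enum_val l]surjective_pairing mem_ranked_arcs => /andP[_ ->].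
by rewrite big1 ?ltxx => [/(_ isT)|z _] //; rewrite E ffunE.
Qed.

Definition carries m u z := [exists l : 'I_#|D|, (enum_val l == (u, z)) && (0 < m l)%N].

Lemma carries_arc m u z : carries m u z -> e u z /\ (rank u < rank z)%N.
Proof.
case/existsP=> l /andP[/eqP E _]; have := enum_valP l.
by rewrite E mem_ranked_arcs => /andP[].
Qed.

Lemma inflow_exists m z : 0 <= boundary m z ->
  0 < boundary m z \/ (exists u, carries m z u) -> exists u, carries m u z.
Proof.
move=> ge0 H; case: (pickP (carries m ^~ z)) => [u|no]; first by exists u.
have t0 l : arc_vector (enum_val l) z * (m l)%:Z <= 0.
  rewrite /arc_vector; case: eqP => [_|ne]; first by rewrite mulN1r oppr_le0.
  case: eqP => [E|_]; last by rewrite mul0r.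
  have := no (enum_val l).1; rewrite /= /carries => /negbT; rewrite negb_exists => /forallP/(_ l).
  by rewrite E -surjective_pairing eqxx /= -eqn0Ngt => /eqP ->; rewrite mulr0.
case: H => [|[u /existsP[l /andP[/eqP El ml]]]].
  by rewrite ffunE ltNge sumr_le0.
suff : boundary m z < 0 by rewrite ltNge ge0.
rewrite ffunE (bigD1 l) //= ltr_wnDr ?sumr_le0 //.
by rewrite El /arc_vector /= eqxx mulN1r oppr_lt0.
Qed.

Lemma outflow_exists m z : boundary m z < 0 -> exists u, carries m z u.
Proof.
move=> lt0; case: (pickP (carries m z)) => [u|no]; first by exists u.
suff : 0 <= boundary m z by rewrite leNgt lt0.
rewrite ffunE sumr_ge0 // => l _.
rewrite /arc_vector; case: eqP => [E|_]; last by case: eqP => _; rewrite ?mul1r ?mul0r.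
have := no (enum_val l).2; rewrite /= /carries => /negbT; rewrite negb_exists => /forallP/(_ l).
by rewrite E -surjective_pairing eqxx /= -eqn0Ngt => /eqP ->; rewrite mulr0.
Qed.

Lemma carried_path_le m u p : uniq p -> path (carries m) u p -> (fw_mnm D u p <= m)%MM.
Proof.
move=> up pp; apply/mnm_lepP => l; have le1 := leq_trans (fw_mnm_count u p l) (uniq_count _ up).
case: (posnP (fw_mnm D u p l)) => [->|gt0] //; apply: leq_trans le1 _.
have /existsP[l' /andP[]] := fw_mnm_gt0 pp gt0.
by rewrite -surjective_pairing => /eqP/enum_val_inj ->.
Qed.

Lemma ranked_boundary u p z : path (fun u z => (u, z) \in D) u p ->
  boundary (fw_mnm D u p) z = (z == last u p)%:Z - (z == u)%:Z.
Proof.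
move=> pp; have pe : path e u p by apply: sub_path pp => a b; rewrite mem_ranked_arcs => /andP[].
rewrite -(boundary_walk ranked_orientation) //.
suff -> : bw_mnm D u p = 0%MM by rewrite boundary0 [X in _ - X]ffunE subr0.
elim: p u pp {pe} => //= c p IHp u /andP[/(proj2 ranked_orientation) nuc /IHp ->].
by rewrite step_mnm0 // addm0.
Qed.

End RankedOrientation.

Section EaredHoleOrientation.
Local Open Scope ring_scope.

Variables (k : fieldType) (V : finType) (e : rel V).
Hypotheses (e_sym : symmetric e) (e_irr : irreflexive e).
Variables (x y w : V) (lw la lb : seq V).
Hypothesis nxy : ~~ e x y.
Hypothesis us0 : uniq (w :: lw ++ x :: y :: la ++ lb).
Hypotheses (exw : e x w) (pw : path e w (rcons lw y)).
Hypotheses (pa : path e x (rcons la y)) (ca : chordless e (x :: rcons la y)).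
Hypotheses (pb : path e x (rcons lb y)) (cb : chordless e (x :: rcons lb y)).
Hypothesis anti : {in la & lb, forall a b, ~~ e a b}.

Let s0 := w :: lw ++ x :: y :: la ++ lb.
Local Notation rk := (rank s0).
Local Notation D := (ranked_arcs e s0).
Local Notation arc := (fun u z => (u, z) \in D).
Implicit Types (u z : V) (m : 'X_{1.. #|D|}).

Let ea := last x la.
Let eb := last x lb.

Let la0 : la != [::].
Proof. by apply: contraNneq nxy => E; move: pa; rewrite E /= andbT. Qed.

Let lb0 : lb != [::].
Proof. by apply: contraNneq nxy => E; move: pb; rewrite E /= andbT. Qed.

Let eaP : ea \in la.
Proof. by rewrite /ea; case: (la) la0 => // c s _; exact: (mem_last c s). Qed.

Let ebP : eb \in lb.
Proof. by rewrite /eb; case: (lb) lb0 => // c s _; exact: (mem_last c s). Qed.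

Let rkxy : (rk x < rk y)%N.
Proof. exact: (@rank_lt _ _ us0 (w :: lw) x [::] y (la ++ lb)). Qed.

Let rkwx : (rk w < rk x)%N.
Proof. exact: (@rank_lt _ _ us0 [::] w lw x (y :: la ++ lb)). Qed.

Let rky u : u \in la ++ lb -> (rk y < rk u)%N.
Proof.
case/mem_split=> p1 [p2 E].
by apply: (@rank_lt _ _ us0 (w :: lw ++ [:: x]) y p1 u p2); rewrite /s0 E /= -catA.
Qed.

Let rkhole u : (rk x <= rk u)%N -> (rk u < size s0)%N -> u \in x :: y :: la ++ lb.
Proof.
rewrite rank_mem => le; rewrite /s0 -cat_cons mem_cat => /orP[|//] uw.
move: le; rewrite leqNgt => /negP[]; have [p1 [p2 E]] := mem_split uw.
by apply: (@rank_lt _ _ us0 p1 u p2 x (y :: la ++ lb)); rewrite /s0 -cat_cons E -catA.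
Qed.

Let rk_size u : u \in x :: y :: la ++ lb -> (rk u < size s0)%N.
Proof. by move=> uh; rewrite rank_mem /s0 in_cons mem_cat uh !orbT. Qed.

Let sub_a : subseq (x :: la) s0.
Proof.
apply: subseq_trans (suffix_subseq (w :: lw) _); rewrite /= eqxx.
by apply: subseq_trans (prefix_subseq la lb) (subseq_cons _ _).
Qed.

Let sub_b : subseq (x :: lb) s0.
Proof.
apply: subseq_trans (suffix_subseq (w :: lw) _); rewrite /= eqxx.
by apply: subseq_trans (suffix_subseq la lb) (subseq_cons _ _).
Qed.

Let ua : uniq (x :: la). Proof. exact: subseq_uniq sub_a us0. Qed.
Let ub : uniq (x :: lb). Proof. exact: subseq_uniq sub_b us0. Qed.

Let arc_a : path arc x la.
Proof.
by apply: ranked_path sub_a => //; move: pa; rewrite rcons_path => /andP[].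
Qed.

Let arc_b : path arc x lb.
Proof.
by apply: ranked_path sub_b => //; move: pb; rewrite rcons_path => /andP[].
Qed.

Let arc_ya : (y, ea) \in D.
Proof.
rewrite mem_ranked_arcs rky ?mem_cat ?eaP // andbT e_sym.
by move: pa; rewrite rcons_path => /andP[].
Qed.

Let arc_yb : (y, eb) \in D.
Proof.
rewrite mem_ranked_arcs rky ?mem_cat ?ebP ?orbT // andbT e_sym.
by move: pb; rewrite rcons_path => /andP[].
Qed.

Let arc_wx : (w, x) \in D.
Proof. by rewrite mem_ranked_arcs e_sym exw. Qed.

Let arc_w : path arc w (rcons lw y).
Proof.
apply: ranked_path => //; rewrite /s0 /= eqxx -cats1 -[y :: _]cat1s.
by rewrite -cat_rcons -cats1; apply: cat_subseq; rewrite ?subseq_refl // -?catA;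
  [apply: prefix_subseq | rewrite sub1seq mem_head].
Qed.

Local Notation mon := (fw_mnm D).
Local Notation stp := (step_mnm D).

(* Along a side p of the hole, the flow leaving a vertex entered it before, which is
   only possible through the preceding vertex of p. *)
Lemma trace_back m p : chordless e (x :: rcons p y) ->
  sorted (fun u z => rk u < rk z)%N p ->
  {in p, forall z, boundary m z = (z == last x p)%:Z} ->
  (forall u z, carries m u z -> z \in p -> u \in x :: y :: p) ->
  ~~ carries m y (last x p) -> path (carries m) x p.
Proof.
move=> cp sp bp sup ny.
suff H s2 : forall s1, p = s1 ++ s2 -> path (carries m) (last x s1) s2 by apply: (H p [::]).
elim: s2 => //= z s2 IHs s1 Ep.
have p2 : path (carries m) z s2 by rewrite -{1}(last_rcons x s1 z); apply: IHs; rewrite cat_rcons.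
rewrite p2 andbT; have zp : z \in p by rewrite Ep mem_cat mem_head orbT.
have [u cuz] : exists u, carries m u z.
  apply: inflow_exists; first by rewrite bp.
  case: (s2) Ep p2 => [|c s] Ep /=; last by case/andP=> c1 _; right; exists c.
  by move=> _; left; rewrite bp // Ep last_cat eqxx.
have [euz rkuz] := carries_arc cuz.
(* The tail [u] must precede [z] on the path. If it is [x] or on [p], chordlessness and the order
   make it the predecessor; if it is [y], then [z] would be the last vertex, which [ny] excludes. *)
have := sup _ _ cuz zp; rewrite !inE => /or3P[/eqP ux|/eqP uy|up].
- case: (s1) Ep => [|c s] Ep /=; first by rewrite -ux.
  move: cp; rewrite Ep rcons_cat => /(@chordless_sep _ _ [:: x] c _ x z).
  by rewrite mem_head !(mem_cat, inE, mem_rcons) eqxx !orbT -ux euz => /(_ isT isT).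
- case: (s2) Ep => [|c s] Ep.
    by move: ny; rewrite Ep last_cat /= -uy cuz.
  have : chordless e ((x :: rcons s1 z) ++ c :: rcons s y).
    by rewrite cat_cons cat_rcons -rcons_cons -rcons_cons -rcons_cat -Ep.
  move/(@chordless_sep _ _ _ _ _ z y); rewrite inE mem_rcons mem_head orbT mem_rcons mem_head.
  by rewrite e_sym -uy euz => /(_ isT isT).
- have us1 : u \in s1.
    move: up; rewrite Ep mem_cat inE => /or3P[//|/eqP E|us2].
      by move: rkuz; rewrite E ltnn.
    move: sp; rewrite Ep => /cat_sorted2[_] /= /(order_path_min _) => /(_ _)/allP/(_ u us2).
    rewrite ltnNge (ltnW rkuz) => H; exfalso; suff : false by [].
    by apply: H => c b a; apply: ltn_trans.
  have : u \in x :: s1 by rewrite inE us1 orbT.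
  rewrite lastI mem_rcons inE => /predU1P[<- //|ub'].
  have : chordless e (belast x s1 ++ last x s1 :: z :: rcons s2 y).
    by rewrite -cat_rcons -lastI /= -rcons_cons -rcons_cat -Ep.
  by move/(@chordless_sep _ _ _ _ _ u z); rewrite ub' mem_head euz => /(_ isT isT).
Qed.

(* The hole x, la, y, lb has the sources x, y and the sinks ea, eb. *)
Definition hole_fst := (mon x la + stp y eb)%MM.
Definition hole_snd := (mon x lb + stp y ea)%MM.

Let oD : orientation e D := ranked_orientation s0 e_sym e_irr.

Let bstp u z v : (u, z) \in D -> boundary (stp u z) v = (v == z)%:Z - (v == u)%:Z.
Proof. exact: (boundary_step oD). Qed.

Let bmon u p v : path arc u p -> boundary (mon u p) v = (v == last u p)%:Z - (v == u)%:Z.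
Proof. exact: ranked_boundary. Qed.

Lemma boundary_hole_fst v : boundary hole_fst v
  = (v == ea)%:Z + (v == eb)%:Z - (v == x)%:Z - (v == y)%:Z.
Proof. by rewrite boundaryDE bmon // bstp // -/ea; ring. Qed.

Lemma boundary_hole_snd v : boundary hole_snd v
  = (v == ea)%:Z + (v == eb)%:Z - (v == x)%:Z - (v == y)%:Z.
Proof. by rewrite boundaryDE bmon // bstp // -/eb; ring. Qed.

Lemma sum_indicator (P : pred V) v : \sum_(z | P z) ((z == v)%:Z) = (P v)%:Z.
Proof.
rewrite big_mkcond (bigD1 v) //= eqxx big1 ?addr0 => [|z /negbTE ->]; by case: ifP.
Qed.

Lemma cut_hole m t : boundary m = boundary hole_fst ->
  \sum_(z | (t <= rk z)%N) boundary m z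
    = (t <= rk ea)%N%:Z + (t <= rk eb)%N%:Z - (t <= rk x)%N%:Z - (t <= rk y)%N%:Z.
Proof.
move=> ->; under eq_bigr => z _ do rewrite boundary_hole_fst.
by rewrite !sumrB big_split /= !sum_indicator.
Qed.

Let rkea : (rk y < rk ea)%N. Proof. by apply: rky; rewrite mem_cat eaP. Qed.
Let rkeb : (rk y < rk eb)%N. Proof. by apply: rky; rewrite mem_cat ebP orbT. Qed.

(** An arc starting below [x] crosses a cut with [x], [y] and both sinks above it, and an arc ending
    outside [s0] crosses one with all four below it. In either case the net inflow across the cut is
    0. *)
Lemma hole_support m u z : boundary m = boundary hole_fst -> carries m u z ->
  u \in x :: y :: la ++ lb /\ z \in x :: y :: la ++ lb.
Proof.
move=> E cuz; have [_ rkuz] := carries_arc cuz.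
have cross t : (rk u < t <= rk z)%N -> 0 <
    (t <= rk ea)%N%:Z + (t <= rk eb)%N%:Z - (t <= rk x)%N%:Z - (t <= rk y)%N%:Z.
  move=> ut; rewrite -(cut_hole t E); case/existsP: cuz => l /andP[/eqP El ml].
  by apply: (cut_crossing e_irr ml); rewrite El.
have xu : (rk x <= rk u)%N.
  rewrite leqNgt; apply/negP => ux; have := cross (rk u).+1.
  rewrite ltnSn rkuz ux (ltn_trans ux rkxy) (ltn_trans ux (ltn_trans rkxy rkea)).
  by rewrite (ltn_trans ux (ltn_trans rkxy rkeb)) => /(_ isT).
have zs : (rk z < size s0)%N.
  rewrite ltnNge; apply/negP => sz; have := cross (rk z).
  have out v : v \in x :: y :: la ++ lb -> (rk z <= rk v)%N = false.
    by move=> /rk_size lt; apply/negbTE; rewrite -ltnNge; apply: leq_trans sz.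
  by rewrite rkuz leqnn !out ?inE ?eqxx ?orbT ?mem_cat ?eaP ?ebP ?orbT // => /(_ isT).
split; apply: rkhole => //; first by apply: leq_trans zs; rewrite ltnS ltnW.
by apply: leq_trans xu _; apply: ltnW.
Qed.

Let ulab : {in la, forall u, u \notin lb}.
Proof.
move=> u ula; apply/negP => ulb; move: us0.
rewrite cons_uniq cat_uniq !cons_uniq cat_uniq.
move=> /andP[_ /and3P[_ _ /and3P[_ _ /and3P[_ /hasPn/(_ u ulb)]]]].
by rewrite /= ula.
Qed.

Let neq_rk u v : (rk u < rk v)%N -> (u == v) = false.
Proof. by move=> lt; apply/eqP => E; move: lt; rewrite E ltnn. Qed.

Let yea : (y == ea) = false. Proof. exact: neq_rk. Qed.
Let yeb : (y == eb) = false. Proof. exact: neq_rk. Qed.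
Let yx : (y == x) = false. Proof. by rewrite eq_sym neq_rk. Qed.

Let eab : ea != eb.
Proof. by apply: contraNneq (ulab eaP) => ->; exact: ebP. Qed.

Lemma end_neighbour p z : chordless e (x :: rcons p y) -> z \in p -> e y z ->
  z = last x p.
Proof.
move=> cp /mem_split[p1 [[|c p2] Ep]] eyz; first by rewrite Ep last_cat.
have : chordless e ((x :: rcons p1 z) ++ c :: rcons p2 y).
  by rewrite cat_cons cat_rcons -rcons_cons -rcons_cons -rcons_cat -Ep.
move/(@chordless_sep _ _ _ _ _ z y); rewrite inE mem_rcons mem_head orbT mem_rcons mem_head.
by rewrite e_sym eyz => /(_ isT isT).
Qed.

Lemma hole_out m z : boundary m = boundary hole_fst -> carries m y z -> z = ea \/ z = eb.
Proof.
move=> E cz; have [eyz _] := carries_arc cz.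
have [_] := hole_support E cz; rewrite !inE mem_cat => /or4P[/eqP zx|/eqP zy|zla|zlb].
- by move: eyz; rewrite zx e_sym (negbTE nxy).
- by move: eyz; rewrite zy e_irr.
- by left; apply: end_neighbour.
- by right; apply: end_neighbour.
Qed.

Lemma hole_in m u : boundary m = boundary hole_fst -> ~~ carries m u y.
Proof.
move=> E; apply/negP => cu; have [euy rkuy] := carries_arc cu.
have [+ _] := hole_support E cu; rewrite !inE => /or3P[/eqP ux|/eqP uy|].
- by move: euy; rewrite ux (negbTE nxy).
- by move: euy; rewrite uy e_irr.
- by move/rky; rewrite ltnNge ltnW.
Qed.

Lemma step_le m u z (c : 'X_{1.. #|D|}) : carries m u z ->
  (forall l, enum_val l = (u, z) -> c l = 0%N) ->
  (c <= m)%MM -> (c + stp u z <= m)%MM.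
Proof.
case/existsP=> l0 /andP[/eqP E0 m0] c0 /mnm_lepP cm; apply/mnm_lepP => l.
rewrite mnmDE [stp u z l]mnmE; case: eqP => [El|_]; last by rewrite addn0.
have -> : l = l0 by apply: enum_val_inj; rewrite El E0.
by rewrite c0.
Qed.

Lemma mon_head u p l : (0 < mon u p l)%N -> (enum_val l).2 \in p.
Proof.
by move=> gt0; rewrite -has_pred1 has_count; apply: leq_trans gt0 (fw_mnm_count _ _ _).
Qed.

Lemma mon_tail p l : y \notin x :: p -> (0 < mon x p l)%N -> (enum_val l).1 != y.
Proof.
move=> yp; apply: (@fw_mnm_gt0 _ _ (fun u _ => u != y)).
elim: p x yp => //= c p IHp u; rewrite inE negb_or eq_sym => /andP[-> ynp].
by rewrite IHp.
Qed.

(** The monomial of the side divides [m], and the quotient has degree 0, so it is 1. *)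
Lemma hole_side m p r : boundary m = boundary (mon x p + stp y r)%MM -> uniq p ->
  r \notin p -> carries m y r -> path (carries m) x p -> m = (mon x p + stp y r)%MM.
Proof.
move=> E up rp cr pp.
have le : (mon x p + stp y r <= m)%MM.
  apply: step_le cr _ (carried_path_le up pp) => l El; apply/eqP; rewrite -leqn0 leqNgt.
  by apply/negP => /mon_head; rewrite El (negbTE rp).
have := submK le; move: E; rewrite -[in X in X -> _](submK le) boundaryD.
rewrite -[X in _ = X]add0r => /addIr/(boundary0_eq0 e_irr) ->.
by rewrite add0m.
Qed.

Lemma boundary_hole_eq : boundary hole_fst = boundary hole_snd.
Proof. by apply/ffunP => v; rewrite boundary_hole_fst boundary_hole_snd. Qed.

(** Flow leaves [y] towards exactly one of the sinks [ea] and [eb]; the other sink is then fed along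
    its side from [x], and this determines [m]. *)
Lemma hole_fiber m : boundary m = boundary hole_fst -> m = hole_fst \/ m = hole_snd.
Proof.
move=> E; have by1 : boundary m y = -1.
  by rewrite E boundary_hole_fst yea yeb yx eqxx.
(* If both arcs at [y] were used, the rest of [m] would have net inflow 1 at [y], but no arc
   carrying flow enters [y]. *)
have nboth : ~~ (carries m y ea && carries m y eb).
  apply/negP => /andP[cea ceb].
  have le : (stp y ea + stp y eb <= m)%MM.
    apply: step_le ceb _ _ => [l El|].
      by rewrite mnmE El xpair_eqE eqxx /= eq_sym (negbTE eab).
    rewrite -[stp y ea]add0m; apply: step_le cea _ _ => [l _|]; first exact: mnm0E.
    by apply/mnm_lepP => l; rewrite mnm0E.
  have [u /existsP[l /andP[El ml]]] : exists u, carries (m - (stp y ea + stp y eb))%MM u y.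
    have := by1; rewrite -{1}(submK le) !boundaryDE !bstp // yea yeb eqxx => H.
    have {}H : boundary (m - (stp y ea + stp y eb))%MM y = 1.
      by move: H; move: (boundary _ y) => b; clear; lia.
    by apply: inflow_exists; rewrite H //; left.
  have /negP[] := hole_in u E; apply/existsP; exists l; rewrite El /=.
  by apply: leq_trans ml _; rewrite mnmBE leq_subr.
have nx u : u \in la ++ lb -> (u == x) = false.
  by move=> /rky yu; rewrite eq_sym neq_rk // (ltn_trans rkxy).
have ny u : u \in la ++ lb -> (u == y) = false by move=> /rky yu; rewrite eq_sym neq_rk.
have ina u : u \in la -> u \in la ++ lb by move=> ?; rewrite mem_cat; apply/orP; left.
have inb u : u \in lb -> u \in la ++ lb by move=> ?; rewrite mem_cat; apply/orP; right.
have [z cz] : exists z, carries m y z by apply: outflow_exists; rewrite by1.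
have [/andP[_ ua'] /andP[_ ub']] : uniq (x :: la) /\ uniq (x :: lb) by [].
case: (hole_out E cz) => zE; subst z; rewrite cz ?andbT /= in nboth.
- right; apply: hole_side => //; rewrite ?E ?boundary_hole_eq //.
    exact: ulab.
  apply: trace_back => //.
  + by move: (sorted_subseq_rank us0 sub_b) => /= /path_sorted.
  + move=> u ulb; rewrite E boundary_hole_fst nx ?inb // ny ?inb // -/eb.
    suff -> : (u == ea) = false by rewrite add0r !subr0.
    by apply/eqP => uE; move: (ulab eaP); rewrite -uE ulb.
  + move=> u v cuv vlb; have [+ _] := hole_support E cuv; have [euv _] := carries_arc cuv.
    rewrite !inE mem_cat => /or4P[->|->|ula|->]; rewrite ?orbT //.
    by move: (anti ula vlb); rewrite euv.
- left; apply: hole_side => //; first by apply: contraL ebP => /ulab.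
  apply: trace_back => //.
  + by move: (sorted_subseq_rank us0 sub_a) => /= /path_sorted.
  + move=> u ula; rewrite E boundary_hole_fst nx ?ina // ny ?ina // -/ea.
    suff -> : (u == eb) = false by rewrite addr0 !subr0.
    by apply/eqP => uE; move: (ulab ula); rewrite uE ebP.
  + move=> u v cuv vla; have [+ _] := hole_support E cuv; have [euv _] := carries_arc cuv.
    rewrite !inE mem_cat => /or4P[->|->|->|ulb]; rewrite ?orbT //.
    by move: (anti vla ulb); rewrite e_sym euv.
Qed.

Lemma hole_disjoint l : hole_fst l = 0%N \/ hole_snd l = 0%N.
Proof.
have ynot p : {subset p <= la ++ lb} -> y \notin x :: p.
  move=> sp; rewrite inE yx; apply/negP => /sp/rky; by rewrite ltnn.
have [ya yb] : y \notin x :: la /\ y \notin x :: lb.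
  by split; apply: ynot => u up; rewrite mem_cat up ?orbT.
case: (posnP (hole_fst l)) => [->|]; first by left.
case: (posnP (hole_snd l)) => [->|]; first by right.
rewrite !mnmDE !addn_gt0 ![stp _ _ _]mnmE !lt0b.
move=> /orP[hb|/eqP Eb] /orP[ha|/eqP Ea].
- by have := mon_head hb; rewrite (negbTE (ulab (mon_head ha))).
- by have := mon_tail yb hb; rewrite Ea /= eqxx.
- by have := mon_tail ya ha; rewrite Eb /= eqxx.
- by move: eab; move: Ea; rewrite Eb => -[->]; rewrite eqxx.
Qed.

(** Two ways from [w] to a sink: over [x] along a side, or along the ear to [y] and then over one
    arc. The exponent differences for the two sinks differ by that of the hole. *)
Lemma ear_boundary p z : path arc x p -> last x p = z -> (y, z) \in D ->
  (forall v, boundary (stp w x + mon x p)%MM v = (v == z)%:Z - (v == w)%:Z) /\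
  boundary (stp w x + mon x p)%MM = boundary (mon w (rcons lw y) + stp y z)%MM.
Proof.
move=> pp lp Dyz; have E v : boundary (stp w x + mon x p)%MM v = (v == z)%:Z - (v == w)%:Z.
  by rewrite boundaryDE bstp // bmon // lp; ring.
split=> //; apply/ffunP => v; rewrite E boundaryDE bstp // bmon //.
by rewrite last_rcons; ring.
Qed.

(** Here [z] is the sink that [a] does not reach. If the degrees were equal, the net inflow of [m]
    into the vertices of rank at least [rk z] would be -1. *)
Lemma ear_degree_small z c m (a : 'X_{1.. #|D|}) : (rk y < rk z)%N -> z = ea \/ z = eb ->
  boundary c = boundary hole_fst ->
  (forall v, boundary a v = (v == (if z == ea then eb else ea))%:Z - (v == w)%:Z) ->
  boundary (m + c)%MM != boundary a.
Proof.
move=> yz zE Ec Ea; apply/eqP => E.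
have := cut_ge0 e_irr m (rk z).
have -> : \sum_(v | (rk z <= rk v)%N) boundary m v =
    \sum_(v | (rk z <= rk v)%N) (boundary a v - boundary c v).
  by apply: eq_bigr => v _; rewrite -E boundaryDE addrK.
rewrite sumrB (cut_hole _ Ec); under eq_bigr => v _ do rewrite Ea.
rewrite sumrB !sum_indicator.
have -> : (rk z <= rk x)%N = false by rewrite leqNgt (ltn_trans rkxy yz).
have -> : (rk z <= rk y)%N = false by rewrite leqNgt yz.
have -> : (rk z <= rk w)%N = false by rewrite leqNgt (ltn_trans rkwx (ltn_trans rkxy yz)).
case: zE => ->; rewrite ?eqxx leqnn.
  by case: (_ <= _)%N.
by rewrite eq_sym (negbTE eab); case: (_ <= _)%N.
Qed.

Lemma eared_hole_not_CIO_seq : ~ CIO k e.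
Proof.
move=> /(_ _ oD); have [a1 E1] := ear_boundary arc_a erefl arc_ya.
have [a2 E2] := ear_boundary arc_b erefl arc_yb.
apply: (not_binomial_complete_intersection e_sym oD boundary_hole_eq _ hole_disjoint
  hole_fiber E1 E2).
- apply/eqP => E; have D0 := arc_yb; pose l := enum_rank_in D0 (y, eb).
  have f1 : (0 < hole_fst l)%N.
    by rewrite mnmDE addn_gt0 [stp _ _ _]mnmE enum_rankK_in // eqxx orbT.
  by case: (hole_disjoint l) f1 => [->|] //; rewrite -E => ->.
- by apply/mnmP => l; rewrite /hole_fst /hole_snd !mnmDE -/ea -/eb; clear; lia.
- move=> a m c Ha Hc; have Ec : boundary c = boundary hole_fst.
    by case/orP: Hc => /eqP ->; rewrite ?boundary_hole_eq.
  case/orP: Ha => /eqP ->.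
    apply: (@ear_degree_small eb) => //; first by right.
    by move=> v; rewrite a1 (eq_sym eb) (negbTE eab).
  apply: (@ear_degree_small ea) => //; first by left.
  by move=> v; rewrite a2 eqxx.
Qed.

End EaredHoleOrientation.

Lemma CIO_ear_free (k : fieldType) (V : finType) (e : rel V) :
  symmetric e -> irreflexive e -> CIO k e -> ear_free e.
Proof.
move=> e_sym e_irr cio x y A B W [[xy nxy] [vA vB vW] anti dAW dBW].
case: (via_induced xy vA) => a [pa ua ca sa].
case: (via_induced xy vB) => b [pb ub cb sb].
case: (via_induced xy vW) => -[|w l] [pw uw _ sw].
  by move: pw; rewrite /= (negbTE nxy).
case/andP: pw => exw pw.
have dis (C D : {set V}) s t : [disjoint C & D] -> {subset s <= C} -> {subset t <= D} ->
    {in s, forall z, z \notin t}.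
  move=> dCD sC sD z /sC zC; apply/negP => /sD zD.
  by move: (disjointFr dCD zC); rewrite zD.
apply: (@eared_hole_not_CIO_seq k V e e_sym e_irr x y w l a b) => //.
(* The ear is moved to the front, where the orientation ranks it lowest. *)
- rewrite -cat_cons uniq_catC 2!cat_cons -catA; apply: (uniq_theta ua ub uw) => [z za||].
  + apply/negP => zb; have [] := anti z z (sa _ za) (sb _ zb); by rewrite eqxx.
  + exact: dis dAW sa sw.
  + exact: dis dBW sb sw.
- by move=> i j /sa iA /sb jB; have [] := anti i j iA jB.
Qed.

Theorem theorem5p10 (k : fieldType) (V : finType) (e : rel V)
    (e_sym : symmetric e) (e_irr : irreflexive e) :
  CIO k e <-> theta_ring e.
Proof.
split=> [/(CIO_ear_free e_sym e_irr)|/theta_ring_ear_free].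
  exact: ear_free_theta_ring.
exact: ear_free_CIO.
Qed.
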